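(* Let $\mathbf{X}$ be a represented space. The following are equivalent: 1. $\mathbf{X}$ is precomputably quasi-Polish and effectively separable. 2. $\mathbf{X}$ is precomputably quasi-Polish and computably overt. 3. $\mathbf{X}$ admits an effectively fiber-overt computably admissible total representation $\delta$ (i.e. $\mathrm{dom}(\delta)=\mathbb{N}^{\mathbb{N}}$). 4. There exists a c.e. transitive relation $\prec\ \subseteq\mathbb{N}\times\mathbb{N}$ such that $\mathbf{X}$ is computably isomorphic to $\mathrm{RI}(\prec)$ and such that $\prec$ has a c.e. extendability predicate $E$.
   Context: A represented space $\mathbf{X}=(X,\delta_X)$ is a set $X$ with a partial surjection $\delta_X:\subseteq\mathbb{N}^{\mathbb{N}}\to X$. A realizer of a partial multivalued function $f:\subseteq\mathbf{X}\rightrightarrows\mathbf{Y}$ is a partial $F:\subseteq\mathbb{N}^{\mathbb{N}}\to\mathbb{N}^{\mathbb{N}}$ with $\delta_Y(F(p))\in f(\delta_X(p))$ for all $p\in\mathrm{dom}(f\circ\delta_X)$; $f$ is computable (continuous) if it has a computable (continuous) realizer. A computable isomorphism is a computable bijection with computable inverse. That $\mathbf{X}$ admits a representation $\delta$ with given properties means that there is a representation $\delta$ of the set $X$ with these properties such that the identity between $(X,\delta_X)$ and $(X,\delta)$ is a computable isomorphism. Sierpinski space $\Sigma$ is $\{\top,\bot\}$ represented by $\delta_\Sigma:\mathbb{N}^{\mathbb{N}}\to\{\top,\bot\}$ with $\delta_\Sigma(p)=\bot$ iff $p=0^\omega$. $\mathcal{O}(\mathbf{X})$ is the represented space of the open sets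 $U\subseteq X$ (those open in the final topology of $\delta_X$), each identified with its continuous characteristic function $\chi_U:\mathbf{X}\to\Sigma$ in the function space $\mathcal{C}(\mathbf{X},\Sigma)$ (represented via a universal machine with oracle, so that evaluation and currying are computable). In particular, $\mathcal{O}(\mathbb{N})$ is the set of all subsets of $\mathbb{N}$, represented by enumerations. $\mathcal{V}(\mathbf{X})$ is the represented space of closed subsets $A$ of $\mathbf{X}$, where $A$ is identified with $\{U\in\mathcal{O}(\mathbf{X})\mid U\cap A\neq\emptyset\}\in\mathcal{O}(\mathcal{O}(\mathbf{X}))$. For a transitive relation $\prec$ on $\mathbb{N}$, $I\subseteq\mathbb{N}$ is a rounded ideal if (i) $I\neq\emptyset$; (ii) $y\in I$ and $x\prec y$ imply $x\in I$; (iii) for all $x,y\in I$ there is $z\in I$ with $x\prec z$ and $y\prec z$. $\mathrm{RI}(\prec)\subseteq\mathcal{O}(\mathbb{N})$ is the subspace of all rounded ideals. The extendability predicate of $\prec$ is $E=\{n\in\mathbb{N}\mid \text{there is a rounded ideal } I \text{ with } n\in I\}$. $\mathbf{X}$ is precomputably quasi-Polish if it is computably isomorphic to $\mathrm{RI}(\prec)$ for some c.e. transitive relation $\prec$ on $\mathbb{N}$. $\mathbf{X}$ is effectively separable if there is a computable sequence $(a_i)_{i\in\mathbb{N}}$ in $\mathbf{X}$ that is dense in $\mathbf{X}$. $\mathbf{X}$ is computably overt if $X$ is a computable element of $\mathcal{V}(\mathbf{X})$, i.e. the map $\mathcal{O}(\mathbf{X})\to\Sigma$ sending $U$ to $\top$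 iff $U\neq\emptyset$ is computable. A representation $\delta$ of $\mathbf{X}$ is effectively fiber-overt if $x\mapsto\overline{\delta^{-1}(\{x\})}:\mathbf{X}\to\mathcal{V}(\mathbb{N}^{\mathbb{N}})$ is computable. It is computably admissible if, for $\mathbf{X}=(X,\delta)$, the computable map $x\mapsto\{U\in\mathcal{O}(\mathbf{X})\mid x\in U\}:\mathbf{X}\to\mathcal{O}(\mathcal{O}(\mathbf{X}))$ is injective with computable partial inverse.
   Formalization: The represented space X is assumed nonempty; for the empty space items 2 and 4 hold (take the empty relation), while items 1 and 3 fail since there is no sequence in X and no total representation. *)

(* Defs.v *)
From Stdlib Require Import Arith Lia Relations.
From Stdlib Require Import Classical ClassicalEpsilon.
From Stdlib Require Import FunctionalExtensionality PropExtensionality ProofIrrelevance.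
From Stdlib Require Cantor.

(** * Computability on Baire space *)

Definition baire := nat -> nat.

Definition npair (a b : nat) : nat := Cantor.to_nat (a, b).
Definition pfst (n : nat) : nat := fst (Cantor.of_nat n).
Definition psnd (n : nat) : nat := snd (Cantor.of_nat n).

(** Programs for the unary partial recursive functions relative to an oracle;
    several arguments are passed through the Cantor pairing. *)
Inductive prog : Type :=
| Zero
| Succ
| Fst
| Snd
| Oracle
| Pair (f g : prog)
| Comp (f g : prog)
| Rec (f g : prog)
| Min (f : prog).

(** [eval e o n m]: the program [e] with oracle [o] halts on [n] with output
    [m].  In the clause for [Rec], [h] is the sequence of successive values of
    the primitive recursion; in the clause for [Min], all values below the
    minimum must be defined and nonzero. *)
Fixpoint eval (e : prog) (o : baire) (n m : nat) : Prop :=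
  match e with
  | Zero => m = 0
  | Succ => m = S n
  | Fst => m = pfst n
  | Snd => m = psnd n
  | Oracle => m = o n
  | Pair f g => exists a b, eval f o n a /\ eval g o n b /\ m = npair a b
  | Comp f g => exists a, eval g o n a /\ eval f o a m
  | Rec f g =>
      exists h : nat -> nat,
        eval f o (pfst n) (h 0) /\
        (forall j, j < psnd n ->
           eval g o (npair (pfst n) (npair j (h j))) (h (S j))) /\
        m = h (psnd n)
  | Min f =>
      eval f o (npair n m) 0 /\
      (forall j, j < m -> exists b, eval f o (npair n j) (S b))
  end.

Definition run (e : prog) (p q : baire) : Prop := forall n, eval e p n (q n).

(** Oracle-free computation is computation with the oracle [0, 0, 0, ...]. *)
Definition zero_oracle : baire := fun _ => 0.

Definition computable_seq (p : baire) : Prop := exists e, run e zero_oracle p.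

Definition ce (A : nat -> Prop) : Prop :=
  exists e, forall n, A n <-> exists m, eval e zero_oracle n m.

Definition ce_rel (R : nat -> nat -> Prop) : Prop :=
  ce (fun n => R (pfst n) (psnd n)).

(** Partial functions on Baire space are given by their graphs
    [F : baire -> baire -> Prop]; both properties below force [F] to be
    single-valued.  A computable partial function may be a restriction of the
    function computed by the machine. *)
Definition computable_pfun (F : baire -> baire -> Prop) : Prop :=
  exists e, forall p q, F p q -> run e p q.

Definition agree (k : nat) (p p' : baire) : Prop :=
  forall i, i < k -> p i = p' i.

Definition continuous_pfun (F : baire -> baire -> Prop) : Prop :=
  forall p q, F p q -> forall n, exists k,
    forall p' q', F p' q' -> agree k p p' -> q' n = q n.

(** * Represented spaces *)

(** [names p x] means that [p] is in the domain of the representation and is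
    mapped to [x]. *)
Record representation (X : Type) : Type := Representation {
  names : baire -> X -> Prop;
  names_fun : forall p x y, names p x -> names p y -> x = y;
  names_surj : forall x, exists p, names p x
}.
Arguments Representation {X}.
Arguments names {X}.
Arguments names_fun {X}.
Arguments names_surj {X}.

Record repspace : Type := RepSpace {
  carrier :> Type;
  rep : representation carrier
}.
Arguments RepSpace {carrier}.

(** A partial multivalued function [f] is given by its graph; its domain is
    the set of those [x] for which some [f x y] holds. *)
Definition realizes (X Y : repspace) (F : baire -> baire -> Prop)
    (f : X -> Y -> Prop) : Prop :=
  forall p x, names (rep X) p x -> (exists y, f x y) ->
    exists q y, F p q /\ names (rep Y) q y /\ f x y.

Definition computable_mv (X Y : repspace) (f : X -> Y -> Prop) : Prop :=
  exists F, computable_pfun F /\ realizes X Y F f.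

Definition continuous_mv (X Y : repspace) (f : X -> Y -> Prop) : Prop :=
  exists F, continuous_pfun F /\ realizes X Y F f.

Definition graph {A B : Type} (f : A -> B) : A -> B -> Prop :=
  fun x y => y = f x.

Definition computable_map (X Y : repspace) (f : X -> Y) : Prop :=
  computable_mv X Y (graph f).

Definition continuous_map (X Y : repspace) (f : X -> Y) : Prop :=
  continuous_mv X Y (graph f).

Definition computable_point (X : repspace) (x : X) : Prop :=
  exists p, names (rep X) p x /\ computable_seq p.

Definition computably_isomorphic (X Y : repspace) : Prop :=
  exists (f : X -> Y) (g : Y -> X),
    (forall x, g (f x) = x) /\ (forall y, f (g y) = y) /\
    computable_map X Y f /\ computable_map Y X g.

(** Open sets of the final topology: the preimage under the representation is
    open in the domain of the representation. *)
Definition is_open (X : repspace) (U : X -> Prop) : Prop :=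
  forall p x, names (rep X) p x -> U x ->
    exists k, forall p' x', names (rep X) p' x' -> agree k p p' -> U x'.

Definition is_closed (X : repspace) (A : X -> Prop) : Prop :=
  is_open X (fun x => ~ A x).

Definition closure (X : repspace) (A : X -> Prop) : X -> Prop :=
  fun x => forall U, is_open X U -> U x -> exists y, U y /\ A y.

Lemma closure_closed (X : repspace) (A : X -> Prop) :
  is_closed X (closure X A).
Proof.
  intros p x Hp Hx.
  apply not_all_ex_not in Hx; destruct Hx as [U HU].
  apply imply_to_and in HU; destruct HU as [Uo HU].
  apply imply_to_and in HU; destruct HU as [Ux HU].
  destruct (Uo p x Hp Ux) as [k Hk].
  exists k; intros p' x' Hp' Hag Hc.
  exact (HU (Hc U Uo (Hk p' x' Hp' Hag))).
Qed.

Lemma sig_eq {A : Type} {P : A -> Prop} (x y : sig P) :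
  proj1_sig x = proj1_sig y -> x = y.
Proof.
  destruct x as [x Hx], y as [y Hy]; simpl; intros ->.
  f_equal; apply proof_irrelevance.
Qed.

Lemma set_ext {A : Type} (U V : A -> Prop) :
  (forall x, U x <-> V x) -> U = V.
Proof.
  intros H; apply functional_extensionality; intros x.
  apply propositional_extensionality, H.
Qed.

Definition subspace (X : repspace) (P : X -> Prop) : repspace.
Proof.
  refine (@RepSpace (sig P) (Representation
            (fun p x => names (rep X) p (proj1_sig x)) _ _)).
  - intros p x y Hx Hy; apply sig_eq; exact (names_fun (rep X) _ _ _ Hx Hy).
  - intros x; apply names_surj.
Defined.

Definition NN : repspace.
Proof.
  refine (@RepSpace baire (Representation (fun p q => p = q) _ _)).
  - intros p x y -> ->; reflexivity.
  - intros x; exists x; reflexivity.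
Defined.

Definition natspace : repspace.
Proof.
  refine (@RepSpace nat (Representation (fun p n => p 0 = n) _ _)).
  - intros p x y <- <-; reflexivity.
  - intros n; exists (fun _ => n); reflexivity.
Defined.

(** The two points of Sierpinski space are the propositions [True] and
    [False]; a characteristic function is then the subset itself. *)
Definition Sierp : repspace.
Proof.
  refine (@RepSpace Prop (Representation
            (fun p P => ~ P <-> p = zero_oracle) _ _)).
  - intros p P Q HP HQ; apply propositional_extensionality.
    destruct (classic P), (classic Q); tauto.
  - intros P; destruct (classic P) as [HP|HP].
    + exists (fun _ => 1); split; [tauto|].
      intros E; apply (f_equal (fun f => f 0)) in E; discriminate E.
    + exists zero_oracle; tauto.
Defined.

(** * Function spaces and hyperspaces *)

(** Code of the finite sequence [p 0, ..., p (k - 1)]. *)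
Fixpoint prefix (p : baire) (k : nat) : nat :=
  match k with
  | 0 => 0
  | S k' => S (npair (p k') (prefix p k'))
  end.

(** The universal oracle machine: with oracle [a] and input [p] it computes
    the [n]-th output symbol by asking [a] about [n] together with longer and
    longer prefixes of [p]; the answer 0 means that more of [p] is to be read,
    and the answer [S m] that the symbol is [m].  The partial functions computed
    for some oracle [a] are exactly the restrictions of continuous ones, and a
    computable partial function is computed for some computable [a]. *)
Definition universal (a p q : baire) : Prop :=
  forall n, exists k,
    a (npair n (prefix p k)) = S (q n) /\
    forall j, j < k -> a (npair n (prefix p j)) = 0.

Lemma universal_fun {a p q q' : baire} :
  universal a p q -> universal a p q' -> q = q'.
Proof.
  intros H H'; apply functional_extensionality; intros n.
  destruct (H n) as [k [Hk Hj]], (H' n) as [k' [Hk' Hj']].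
  destruct (lt_eq_lt_dec k k') as [[L|L]|L].
  - specialize (Hj' _ L); congruence.
  - subst k'; congruence.
  - specialize (Hj _ L); congruence.
Qed.

Lemma npair_inj (a b c d : nat) : npair a b = npair c d -> a = c /\ b = d.
Proof.
  intros H; apply (f_equal Cantor.of_nat) in H; unfold npair in H.
  rewrite !Cantor.cancel_of_to in H; inversion H; auto.
Qed.

Lemma prefix_agree (k k' : nat) (p p' : baire) :
  prefix p k = prefix p' k' -> k = k' /\ agree k p p'.
Proof.
  revert k'; induction k as [|k IH]; intros [|k'] H; simpl in H;
    try discriminate H.
  - split; [reflexivity|intros i Hi; lia].
  - injection H as H; apply npair_inj in H; destruct H as [H1 H2].
    destruct (IH _ H2) as [-> Hag]; split; [reflexivity|].
    intros i Hi; destruct (Nat.eq_dec i k') as [->|]; [exact H1|].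
    apply Hag; lia.
Qed.

Lemma universal_complete (F : baire -> baire -> Prop) :
  continuous_pfun F -> exists a, forall p q, F p q -> universal a p q.
Proof.
  intros HF.
  set (P := fun n w m => forall p k q, F p q -> prefix p k = w -> q n = m).
  set (R := fun c v => match v with
              | S m => P (pfst c) (psnd c) m
              | 0 => ~ exists m, P (pfst c) (psnd c) m
              end).
  assert (HR : forall c, exists v, R c v).
  { intros c; destruct (classic (exists m, P (pfst c) (psnd c) m)) as [[m H]|H].
    - exists (S m); exact H.
    - exists 0; exact H. }
  assert (Hch : exists a : baire, forall c, R c (a c)).
  { exists (fun c => proj1_sig (constructive_indefinite_description _ (HR c))).
    intros c; exact (proj2_sig (constructive_indefinite_description _ (HR c))). }
  destruct Hch as [a Ha]; exists a; intros p q Hpq n.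
  assert (Hex : exists k, a (npair n (prefix p k)) <> 0).
  { destruct (HF p q Hpq n) as [k Hk]; exists k; intros E.
    specialize (Ha (npair n (prefix p k))); rewrite E in Ha; apply Ha.
    exists (q n).
    unfold pfst, psnd, npair; rewrite Cantor.cancel_of_to; simpl.
    intros p' k' q' HF' E'; symmetry in E'.
    apply prefix_agree in E'; destruct E' as [_ E'].
    exact (Hk p' q' HF' E'). }
  assert (Hmin : exists k, a (npair n (prefix p k)) <> 0 /\
            forall j, j < k -> a (npair n (prefix p j)) = 0).
  { destruct Hex as [k Hk]; revert Hk.
    induction k as [k IH] using lt_wf_ind; intros Hk.
    destruct (classic (exists j, j < k /\ a (npair n (prefix p j)) <> 0))
      as [[j [Hj Hj']]|H].
    - exact (IH j Hj Hj').
    - exists k; split; [exact Hk|]; intros j Hj; apply NNPP; intros N.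
      apply H; exists j; auto. }
  destruct Hmin as [k [Hk Hj]]; exists k; split; [|exact Hj].
  specialize (Ha (npair n (prefix p k))).
  destruct (a (npair n (prefix p k))) as [|m]; [congruence|].
  unfold R, P, pfst, psnd, npair in Ha; rewrite Cantor.cancel_of_to in Ha.
  simpl in Ha; rewrite (Ha p k q Hpq eq_refl); reflexivity.
Qed.

(** [ContSpace X Y] consists of the continuous functions from [X] to [Y]; a name
    of [f] is an oracle with which the universal machine computes a realizer of
    [f]. *)
Definition ContSpace (X Y : repspace) : repspace.
Proof.
  refine (@RepSpace {f : X -> Y | continuous_map X Y f}
            (Representation
               (fun a f => realizes X Y (universal a) (graph (proj1_sig f))) _ _)).
  - intros a f g Hf Hg; apply sig_eq, functional_extensionality; intros x.
    destruct (names_surj (rep X) x) as [p Hp].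
    destruct (Hf p x Hp (ex_intro _ _ eq_refl)) as [q [y [Hq [Hy Ey]]]].
    destruct (Hg p x Hp (ex_intro _ _ eq_refl)) as [q' [y' [Hq' [Hy' Ey']]]].
    unfold graph in Ey, Ey'.
    rewrite (universal_fun Hq' Hq) in Hy'.
    rewrite <- Ey, <- Ey'; exact (names_fun (rep Y) _ _ _ Hy Hy').
  - intros [f [F [HF Hf]]]; destruct (universal_complete F HF) as [a Ha].
    exists a; intros p x Hp Hx.
    destruct (Hf p x Hp Hx) as [q [y [Hq H]]].
    exists q, y; auto.
Defined.

Lemma open_continuous (X : repspace) (U : X -> Prop) :
  is_open X U -> continuous_map X Sierp U.
Proof.
  intros HU.
  set (B := fun p k => forall p' x', names (rep X) p' x' -> agree k p p' -> U x').
  exists (fun p q => forall n, (B p n -> q n = 1) /\ (~ B p n -> q n = 0)).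
  split.
  - intros p q Hpq n; exists n; intros p' q' Hpq' Hag.
    assert (E : B p n <-> B p' n).
    { split; intros H r x Hr Hag'; apply (H r x Hr); intros i Hi.
      - rewrite (Hag i Hi); auto.
      - rewrite <- (Hag i Hi); auto. }
    destruct (Hpq n) as [H1 H2], (Hpq' n) as [H1' H2'].
    destruct (classic (B p n)) as [H|H].
    + rewrite H1, H1'; tauto.
    + rewrite H2, H2'; tauto.
  - intros p x Hp _.
    exists (fun n => if excluded_middle_informative (B p n) then 1 else 0), (U x).
    split; [|split; [|reflexivity]].
    + intros n; destruct (excluded_middle_informative (B p n)); tauto.
    + simpl; split.
      * intros Hx; apply functional_extensionality; intros n; unfold zero_oracle.
        destruct (excluded_middle_informative (B p n)) as [H|H]; [|reflexivity].
        destruct Hx; apply (H p x Hp); intros i _; reflexivity.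
      * intros E Hx; destruct (HU p x Hp Hx) as [k Hk].
        apply (f_equal (fun f => f k)) in E; unfold zero_oracle in E.
        destruct (excluded_middle_informative (B p k)) as [H|H];
          [discriminate E|exact (H Hk)].
Qed.

Definition char_fun (X : repspace) (U : {U : X -> Prop | is_open X U}) :
    ContSpace X Sierp :=
  exist _ (proj1_sig U) (open_continuous X _ (proj2_sig U)).

Definition OpenSets (X : repspace) : repspace.
Proof.
  refine (@RepSpace {U : X -> Prop | is_open X U}
            (Representation
               (fun a U => names (rep (ContSpace X Sierp)) a (char_fun X U)) _ _)).
  - intros a U V HU HV; apply sig_eq.
    exact (f_equal (@proj1_sig _ _)
             (names_fun (rep (ContSpace X Sierp)) _ _ _ HU HV)).
  - intros U; apply names_surj.
Defined.

Definition in_open (X : repspace) (x : X) (U : OpenSets X) : Prop :=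
  proj1_sig U x.

Lemma nbhds_open (X : repspace) (x : X) : is_open (OpenSets X) (in_open X x).
Proof.
  intros a U Ha Hx.
  destruct (names_surj (rep X) x) as [p Hp].
  destruct (Ha p x Hp (ex_intro _ _ eq_refl)) as [q [y [Hq [Hy Ey]]]].
  unfold graph in Ey; subst y; simpl in Hy.
  assert (Hn : exists n, q n <> 0).
  { apply NNPP; intros N; apply Hy; [|exact Hx].
    apply functional_extensionality; intros n; apply NNPP; intros N'.
    apply N; exists n; exact N'. }
  destruct Hn as [n Hn]; destruct (Hq n) as [k [Hk Hj]].
  assert (HK : exists K, forall j, j <= k -> npair n (prefix p j) < K).
  { clear; induction k as [|k [K IH]].
    - exists (S (npair n (prefix p 0))); intros j Hj.
      replace j with 0 by lia; lia.
    - exists (K + S (npair n (prefix p (S k)))); intros j Hj.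
      destruct (Nat.eq_dec j (S k)) as [->|]; [lia|].
      specialize (IH j ltac:(lia)); lia. }
  destruct HK as [K HK]; exists K; intros a' U' Ha' Hag.
  destruct (Ha' p x Hp (ex_intro _ _ eq_refl)) as [q' [y' [Hq' [Hy' Ey']]]].
  unfold graph in Ey'; subst y'; simpl in Hy'.
  apply NNPP; intros N; apply Hy' in N; subst q'.
  destruct (Hq' n) as [k' [Hk' Hj']].
  destruct (lt_eq_lt_dec k k') as [[L|L]|L].
  - specialize (Hj' _ L); rewrite <- Hag in Hj' by (apply HK; lia); congruence.
  - subst k'; rewrite <- Hag in Hk' by (apply HK; lia).
    rewrite Hk in Hk'; injection Hk'; exact Hn.
  - specialize (Hj _ L); rewrite <- Hag in Hk' by (apply HK; lia); congruence.
Qed.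

Definition nbhds (X : repspace) (x : X) : OpenSets (OpenSets X) :=
  exist _ (in_open X x) (nbhds_open X x).

Lemma meets_open (X : repspace) (A : X -> Prop) :
  is_open (OpenSets X) (fun U : OpenSets X => exists x, in_open X x U /\ A x).
Proof.
  intros a U Ha [x [Hx Ax]].
  destruct (nbhds_open X x a U Ha Hx) as [k Hk].
  exists k; intros a' U' Ha' Hag; exists x; split; [|exact Ax].
  exact (Hk a' U' Ha' Hag).
Qed.

Definition meets (X : repspace) (A : X -> Prop) : OpenSets (OpenSets X) :=
  exist _ (fun U : OpenSets X => exists x, in_open X x U /\ A x) (meets_open X A).

Definition ClosedSets (X : repspace) : repspace.
Proof.
  refine (@RepSpace {A : X -> Prop | is_closed X A}
            (Representation
               (fun a A =>
                  names (rep (OpenSets (OpenSets X))) a (meets X (proj1_sig A)))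
               _ _)).
  - assert (W : forall A B : {A : X -> Prop | is_closed X A},
        meets X (proj1_sig A) = meets X (proj1_sig B) ->
        forall x, proj1_sig A x -> proj1_sig B x).
    { intros A B E x Hx; apply NNPP; intros N.
      set (U := exist _ (fun x => ~ proj1_sig B x) (proj2_sig B) : OpenSets X).
      apply (f_equal (fun W => proj1_sig W U)) in E; simpl in E.
      assert (H : exists x, in_open X x U /\ proj1_sig B x).
      { cbv beta in E; unfold in_open in E |- *; simpl.
        rewrite <- E; exists x; split; [exact N|exact Hx]. }
      destruct H as [y [H1 H2]]; exact (H1 H2). }
    intros a A B HA HB.
    pose proof (names_fun (rep (OpenSets (OpenSets X))) _ _ _ HA HB) as E.
    apply sig_eq, set_ext; intros x; split; apply W; congruence.
  - intros A; apply names_surj.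
Defined.

Definition closureV (X : repspace) (A : X -> Prop) : ClosedSets X :=
  exist _ (closure X A) (closure_closed X A).

Lemma full_closed (X : repspace) : is_closed X (fun _ => True).
Proof. intros p x _ H; destruct (H I). Qed.

Definition fullV (X : repspace) : ClosedSets X :=
  exist _ (fun _ => True) (full_closed X).

(** * Rounded ideals *)

(** The space of all subsets of the natural numbers represented by
    enumerations; the value 0 enumerates nothing, so that the empty set has a
    name. *)
Definition ON : repspace.
Proof.
  refine (@RepSpace (nat -> Prop) (Representation
            (fun p A => forall n, A n <-> exists k, p k = S n) _ _)).
  - intros p A B HA HB; apply set_ext; intros n.
    rewrite HA, HB; reflexivity.
  - intros A.
    exists (fun k => if excluded_middle_informative (A k) then S k else 0).
    intros n; split.
    + intros Hn; exists n.
      destruct (excluded_middle_informative (A n)); tauto.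
    + intros [k Hk]; destruct (excluded_middle_informative (A k));
        [injection Hk as <-; assumption|discriminate Hk].
Defined.

Definition rounded_ideal (R : nat -> nat -> Prop) (I : nat -> Prop) : Prop :=
  (exists x, I x) /\
  (forall x y, I y -> R x y -> I x) /\
  (forall x y, I x -> I y -> exists z, I z /\ R x z /\ R y z).

Definition RI (R : nat -> nat -> Prop) : repspace :=
  subspace ON (rounded_ideal R).

Definition extendable (R : nat -> nat -> Prop) (n : nat) : Prop :=
  exists I, rounded_ideal R I /\ I n.

(** * Properties of spaces and representations *)

Definition precomputably_quasi_Polish (X : repspace) : Prop :=
  exists R, transitive nat R /\ ce_rel R /\ computably_isomorphic X (RI R).

Definition effectively_separable (X : repspace) : Prop :=
  exists a : nat -> X, computable_map natspace X a /\
    forall U, is_open X U -> (exists x, U x) -> exists i, U (a i).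

Definition computably_overt (X : repspace) : Prop :=
  computable_point (ClosedSets X) (fullV X).

Definition total {X : Type} (d : representation X) : Prop :=
  forall p, exists x, names d p x.

Definition effectively_fiber_overt {X : Type} (d : representation X) : Prop :=
  computable_map (RepSpace d) (ClosedSets NN)
    (fun x => closureV NN (fun p => names d p x)).

Definition computably_admissible {X : Type} (d : representation X) : Prop :=
  (forall x y : RepSpace d,
     nbhds (RepSpace d) x = nbhds (RepSpace d) y -> x = y) /\
  computable_mv (OpenSets (OpenSets (RepSpace d))) (RepSpace d)
    (fun W x => nbhds (RepSpace d) x = W).

(** [d] is a representation of the underlying set of [X] for which the identity
    is a computable isomorphism. *)
Definition admits (X : repspace) (d : representation X) : Prop :=
  computable_map X (RepSpace d) (fun x => x) /\
  computable_map (RepSpace d) X (fun x => x).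

(* Main.v *)
Require Import Defs.
From Stdlib Require Import Arith Lia List Relations.
From Stdlib Require Import Classical ClassicalEpsilon FunctionalExtensionality.
From Stdlib Require Cantor.

(** Separability implies overtness by testing the dense sequence, and overtness
    of [RI R] makes [extendable R] c.e. because [n] is extendable iff the open set
    of ideals containing [n] is nonempty.

    If [R] and [extendable R] are c.e., every sequence of choices can be read as an
    infinite [R]-chain of extendable numbers, each choice selecting the next link
    in an enumeration of the admissible ones.  Sending it to the ideal generated by
    the chain is a total representation, and a finite sequence of choices extends
    to a name of [I] iff its last link lies in [I], so the fibers are overt.

    Conversely, let [d] be total, admissible and fiber-overt.  The images under [d]
    of cylinders are uniformly c.e. open, hence a base, and [x] is determined by the
    set [I] of words [w] with [x] in the image of the cylinder of [w].  These sets
    are the ones closed under a decidable forcing relation and such that any [w]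
    in [I] has a proper extension in [I] forcing a given [v] in [I]; totality turns
    a path through such an [I] into a point.  Ordering the finite sets of words,
    tagged with a stage, by "[c] is contained in [d], and [d] meets the demands
    [c] makes up to its stage" gives a transitive decidable relation whose rounded
    ideals are exactly the families of finite subsets of such [I]. *)

(** * Pairing and determinism of evaluation *)

Lemma pfst_npair a b : pfst (npair a b) = a.
Proof. unfold pfst, npair; now rewrite Cantor.cancel_of_to. Qed.

Lemma psnd_npair a b : psnd (npair a b) = b.
Proof. unfold psnd, npair; now rewrite Cantor.cancel_of_to. Qed.

Lemma npair_eta n : npair (pfst n) (psnd n) = n.
Proof.
  unfold npair, pfst, psnd; rewrite <- surjective_pairing.
  apply Cantor.cancel_to_of.
Qed.

Lemma npair_ge a b : a <= npair a b /\ b <= npair a b.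
Proof.
  pose proof (Cantor.to_nat_non_decreasing a b); unfold npair; lia.
Qed.

Lemma psnd_le n : psnd n <= n.
Proof. rewrite <- (npair_eta n) at 2; apply npair_ge. Qed.

Lemma eval_fun e o n m m' : eval e o n m -> eval e o n m' -> m = m'.
Proof.
  revert n m m'; induction e; simpl; intros n m m' H H'; try congruence.
  - destruct H as (a & b & Ha & Hb & ->), H' as (a' & b' & Ha' & Hb' & ->).
    f_equal; eauto.
  - destruct H as (a & Ha & Hm), H' as (a' & Ha' & Hm').
    rewrite (IHe2 _ _ _ Ha Ha') in Hm; eauto.
  - destruct H as (h & H0 & HS & ->), H' as (h' & H0' & HS' & ->).
    assert (E : forall j, j <= psnd n -> h j = h' j).
    { induction j as [|j IH]; intros Hj; [eauto|].
      specialize (HS j Hj); specialize (HS' j Hj).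
      rewrite (IH ltac:(lia)) in HS; eauto. }
    auto.
  - destruct H as [H0 HS], H' as [H0' HS'].
    destruct (lt_eq_lt_dec m m') as [[L|L]|L]; [|exact L|].
    + destruct (HS' _ L) as [b Hb]; pose proof (IHe _ _ _ H0 Hb); lia.
    + destruct (HS _ L) as [b Hb]; pose proof (IHe _ _ _ H0' Hb); lia.
Qed.

(** * Total functions computable with an oracle *)

(** One program serves all oracles, and the equivalence makes it halt on every input, so closure
    under composition needs no conditions on domains. *)
Definition comp (F : baire -> nat -> nat) : Prop :=
  exists e, forall o n m, eval e o n m <-> m = F o n.

Lemma comp_ext F G : (forall o n, F o n = G o n) -> comp F -> comp G.
Proof. intros E [e He]; exists e; intros o n m; rewrite <- E; apply He. Qed.

Lemma comp_const c : comp (fun _ _ => c).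
Proof.
  induction c as [|c [e He]].
  - exists Zero; simpl; tauto.
  - exists (Comp Succ e); intros o n m; simpl; split.
    + intros (a & Ha & ->); apply He in Ha; now subst.
    + intros ->; exists c; split; [now apply He|reflexivity].
Qed.

Lemma comp_fst f : comp f -> comp (fun o n => pfst (f o n)).
Proof.
  intros [e He]; exists (Comp Fst e); intros o n m; simpl; split.
  - intros (a & Ha & ->); apply He in Ha; now subst.
  - intros ->; exists (f o n); split; [now apply He|reflexivity].
Qed.

Lemma comp_snd f : comp f -> comp (fun o n => psnd (f o n)).
Proof.
  intros [e He]; exists (Comp Snd e); intros o n m; simpl; split.
  - intros (a & Ha & ->); apply He in Ha; now subst.
  - intros ->; exists (f o n); split; [now apply He|reflexivity].
Qed.

Lemma comp_S f : comp f -> comp (fun o n => S (f o n)).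
Proof.
  intros [e He]; exists (Comp Succ e); intros o n m; simpl; split.
  - intros (a & Ha & ->); apply He in Ha; now subst.
  - intros ->; exists (f o n); split; [now apply He|reflexivity].
Qed.

Lemma comp_oracle f : comp f -> comp (fun o n => o (f o n)).
Proof.
  intros [e He]; exists (Comp Oracle e); intros o n m; simpl; split.
  - intros (a & Ha & ->); apply He in Ha; now subst.
  - intros ->; exists (f o n); split; [now apply He|reflexivity].
Qed.

Lemma comp_pair f g : comp f -> comp g -> comp (fun o n => npair (f o n) (g o n)).
Proof.
  intros [e He] [e' He']; exists (Pair e e'); intros o n m; simpl; split.
  - intros (a & b & Ha & Hb & ->); apply He in Ha; apply He' in Hb; now subst.
  - intros ->; exists (f o n), (g o n); rewrite He, He'; auto.
Qed.

Lemma comp_id : comp (fun _ n => n).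
Proof.
  exists (Pair Fst Snd); intros o n m; simpl; split.
  - intros (a & b & -> & -> & ->); apply npair_eta.
  - intros ->; exists (pfst n), (psnd n); rewrite npair_eta; auto.
Qed.

Lemma comp_app f g : comp f -> comp g -> comp (fun o n => f o (g o n)).
Proof.
  intros [e He] [e' He']; exists (Comp e e'); intros o n m; simpl; split.
  - intros (a & Ha & Hm); apply He' in Ha; apply He in Hm; now subst.
  - intros ->; exists (g o n); rewrite He, He'; auto.
Qed.

Lemma comp_app2 F f g : comp (fun o c => F o (pfst c) (psnd c)) ->
  comp f -> comp g -> comp (fun o n => F o (f o n) (g o n)).
Proof.
  intros HF Hf Hg; apply (comp_ext (fun o n => F o
    (pfst (npair (f o n) (g o n))) (psnd (npair (f o n) (g o n))))).
  - intros o n; now rewrite pfst_npair, psnd_npair.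
  - exact (comp_app _ _ HF (comp_pair _ _ Hf Hg)).
Qed.

Fixpoint prec (b : nat) (s : nat -> nat -> nat) (k : nat) : nat :=
  match k with 0 => b | S k' => s k' (prec b s k') end.

(** [Rec] expects a parameter paired with the number of rounds; the input [n] is the parameter, and
    [k] is substituted for the rounds afterwards. *)
Lemma comp_prec b s k : comp b ->
  comp (fun o c => s o (pfst c) (pfst (psnd c)) (psnd (psnd c))) -> comp k ->
  comp (fun o n => prec (b o n) (s o n) (k o n)).
Proof.
  intros [eb Hb] [es Hs] Hk.
  assert (H : comp (fun o c => prec (b o (pfst c)) (s o (pfst c)) (psnd c))).
  { exists (Rec eb es); intros o c m; simpl; split.
    - intros (h & H0 & HS & ->); apply Hb in H0.
      assert (E : forall j, j <= psnd c ->
          h j = prec (b o (pfst c)) (s o (pfst c)) j).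
      { induction j as [|j IH]; intros Hj; [exact H0|].
        specialize (HS j Hj); apply Hs in HS; rewrite HS; simpl.
        rewrite !psnd_npair, !pfst_npair, IH by lia; reflexivity. }
      apply E; lia.
    - intros ->; exists (prec (b o (pfst c)) (s o (pfst c))).
      split; [now apply Hb|split; [|reflexivity]].
      intros j Hj; apply Hs; now rewrite !psnd_npair, !pfst_npair. }
  exact (comp_app2 (fun o x y => prec (b o x) (s o x) y) _ _ H comp_id Hk).
Qed.

Ltac comp_basic :=
  cbv beta;
  first [simple apply comp_const | lazymatch goal with
  | |- comp (fun o n => n) => apply comp_id
  | |- comp (fun o n => pfst _) => apply comp_fst
  | |- comp (fun o n => psnd _) => apply comp_snd
  | |- comp (fun o n => S _) => apply comp_S
  | |- comp (fun o n => npair _ _) => apply comp_pair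
  | |- comp (fun o n => o _) => apply comp_oracle
  end].

Lemma comp_pred f : comp f -> comp (fun o n => pred (f o n)).
Proof.
  (* The step function returns the round index, whose last value is the predecessor of [f o n]. *)
  intros Hf; apply (comp_ext (fun o n => prec 0 (fun j _ => j) (f o n))).
  - intros o n; destruct (f o n); reflexivity.
  - apply (comp_prec (fun _ _ => 0) (fun _ _ j _ => j)); repeat comp_basic.
    exact Hf.
Qed.

Lemma comp_add f g : comp f -> comp g -> comp (fun o n => f o n + g o n).
Proof.
  intros Hf Hg; apply (comp_ext (fun o n => prec (f o n) (fun _ a => S a) (g o n))).
  - intros o n; induction (g o n) as [|k IH]; simpl; lia.
  - apply (comp_prec _ (fun _ _ _ a => S a)); repeat comp_basic; assumption.
Qed.

Lemma comp_sub f g : comp f -> comp g -> comp (fun o n => f o n - g o n).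
Proof.
  intros Hf Hg; apply (comp_ext (fun o n => prec (f o n) (fun _ a => pred a) (g o n))).
  - intros o n; induction (g o n) as [|k IH]; simpl; lia.
  - apply (comp_prec _ (fun _ _ _ a => pred a)); try assumption.
    apply comp_pred; repeat comp_basic.
Qed.

Definition bsum (f : nat -> nat) (k : nat) : nat := prec 0 (fun j a => f j + a) k.

Lemma bsum_zero f k : bsum f k = 0 <-> forall j, j < k -> f j = 0.
Proof.
  induction k as [|k IH]; unfold bsum in *; simpl.
  - split; [intros _ j Hj; lia|reflexivity].
  - split.
    + intros H j Hj; destruct (Nat.eq_dec j k) as [->|]; [lia|].
      apply IH; lia.
    + intros H; rewrite (H k) by lia; apply IH; intros j Hj; apply H; lia.
Qed.

Lemma comp_bsum f k : comp (fun o c => f o (pfst c) (psnd c)) -> comp k ->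
  comp (fun o n => bsum (f o n) (k o n)).
Proof.
  intros Hf Hk; unfold bsum.
  apply (comp_prec (fun _ _ => 0) (fun o n j a => f o n j + a));
    [comp_basic| |exact Hk].
  apply comp_add; [|repeat comp_basic].
  apply (comp_app2 f); [exact Hf| |]; repeat comp_basic.
Qed.

(** * Decidable predicates *)

(** The value 0 stands for truth: conjunction becomes a sum, [<=] truncated subtraction, and a
    bounded universal quantifier [bsum]. *)
Definition dec (P : baire -> nat -> Prop) : Prop :=
  exists f, comp f /\ forall o n, P o n <-> f o n = 0.

Lemma dec_ext P Q : (forall o n, P o n <-> Q o n) -> dec P -> dec Q.
Proof. intros E [f [Hf HP]]; exists f; split; [exact Hf|]; intros; now rewrite <- E. Qed.

Lemma dec_le f g : comp f -> comp g -> dec (fun o n => f o n <= g o n).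
Proof.
  intros Hf Hg; exists (fun o n => f o n - g o n); split; [now apply comp_sub|].
  intros; lia.
Qed.

Lemma dec_lt f g : comp f -> comp g -> dec (fun o n => f o n < g o n).
Proof. intros Hf Hg; apply dec_le; [now apply comp_S|exact Hg]. Qed.

Lemma dec_and P Q : dec P -> dec Q -> dec (fun o n => P o n /\ Q o n).
Proof.
  intros [f [Hf HP]] [g [Hg HQ]]; exists (fun o n => f o n + g o n).
  split; [now apply comp_add|]; intros; rewrite HP, HQ; lia.
Qed.

Lemma dec_not P : dec P -> dec (fun o n => ~ P o n).
Proof.
  intros [f [Hf HP]]; exists (fun o n => 1 - f o n).
  split; [apply comp_sub; [comp_basic|exact Hf]|]; intros; rewrite HP; lia.
Qed.

Lemma dec_or P Q : dec P -> dec Q -> dec (fun o n => P o n \/ Q o n).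
Proof.
  intros HP HQ; apply (dec_ext (fun o n => ~ (~ P o n /\ ~ Q o n))).
  - intros o n; split; [|tauto]; intros H.
    destruct (classic (P o n)), (classic (Q o n)); tauto.
  - now apply dec_not, dec_and; apply dec_not.
Qed.

Lemma dec_imp P Q : dec P -> dec Q -> dec (fun o n => P o n -> Q o n).
Proof.
  intros HP HQ; apply (dec_ext (fun o n => ~ P o n \/ Q o n)).
  - intros o n; destruct (classic (P o n)); tauto.
  - apply dec_or; [now apply dec_not|exact HQ].
Qed.

Lemma dec_eq f g : comp f -> comp g -> dec (fun o n => f o n = g o n).
Proof.
  intros Hf Hg; apply (dec_ext (fun o n => f o n <= g o n /\ g o n <= f o n)).
  - intros; lia.
  - apply dec_and; now apply dec_le.
Qed.

Lemma dec_ball P k : dec (fun o c => P o (pfst c) (psnd c)) -> comp k ->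
  dec (fun o n => forall i, i < k o n -> P o n i).
Proof.
  intros [f [Hf HP]] Hk; exists (fun o n => bsum (fun i => f o (npair n i)) (k o n)).
  split.
  - apply (comp_bsum (fun o n i => f o (npair n i))); [|exact Hk].
    apply (comp_app f); [exact Hf|repeat comp_basic].
  - intros o n; rewrite bsum_zero; split; intros H i Hi.
    + apply HP; rewrite pfst_npair, psnd_npair; auto.
    + specialize (HP o (npair n i)); rewrite pfst_npair, psnd_npair in HP.
      apply HP; auto.
Qed.

Lemma dec_bex P k : dec (fun o c => P o (pfst c) (psnd c)) -> comp k ->
  dec (fun o n => exists i, i < k o n /\ P o n i).
Proof.
  intros HP Hk; apply (dec_ext (fun o n => ~ forall i, i < k o n -> ~ P o n i)).
  - intros o n; split.
    + intros H; apply NNPP; intros N; apply H; intros i Hi Hp; eauto.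
    + intros (i & Hi & Hp) H; exact (H i Hi Hp).
  - apply dec_not, (dec_ball (fun o n i => ~ P o n i)); [now apply dec_not|exact Hk].
Qed.

Lemma dec_app P f : dec P -> comp f -> dec (fun o n => P o (f o n)).
Proof.
  intros [g [Hg HP]] Hf; exists (fun o n => g o (f o n)).
  split; [now apply comp_app|]; intros; apply HP.
Qed.

Lemma dec_app2 P f g : dec (fun o c => P o (pfst c) (psnd c)) ->
  comp f -> comp g -> dec (fun o n => P o (f o n) (g o n)).
Proof.
  intros HP Hf Hg; apply (dec_ext (fun o n => P o
    (pfst (npair (f o n) (g o n))) (psnd (npair (f o n) (g o n))))).
  - intros o n; now rewrite pfst_npair, psnd_npair.
  - exact (dec_app _ _ HP (comp_pair _ _ Hf Hg)).
Qed.

Definition decide (P : Prop) : {P} + {~ P} := excluded_middle_informative P.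

Lemma comp_if P f g : dec P -> comp f -> comp g ->
  comp (fun o n => if decide (P o n) then f o n else g o n).
Proof.
  intros [t [Ht HP]] Hf Hg.
  (* Zero rounds return the first branch, any positive number of rounds the second. *)
  apply (comp_ext (fun o n => prec (f o n) (fun _ _ => g o n) (t o n))).
  - intros o n; destruct (decide (P o n)) as [H|H].
    + apply HP in H; now rewrite H.
    + rewrite HP in H; destruct (t o n); [congruence|reflexivity].
  - apply (comp_prec _ (fun o n _ _ => g o n)); try assumption.
    apply (comp_app g); [exact Hg|repeat comp_basic].
Qed.

(** * Codes of finite sequences *)

(** [prefix] keeps the newest entry outermost, so each round deletes the last entry, and the empty
    code 0 stays 0. *)
Definition tln (w i : nat) : nat := prec w (fun _ a => psnd (pred a)) i.
(** Counts the nonzero iterated truncations: [1 - (1 - t)] is the sign of [t], and [w] rounds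
    suffice since a code is at least as large as its length. *)
Definition plen (w : nat) : nat := bsum (fun j => 1 - (1 - tln w j)) w.
Definition ptake (w j : nat) : nat := tln w (plen w - j).
(** Beyond the length of [w] this has a junk value, so that [pnth w] is an
    infinite sequence with the initial segment [w]. *)
Definition pnth (w i : nat) : nat := pfst (pred (ptake w (S i))).

Lemma comp_tln f g : comp f -> comp g -> comp (fun o n => tln (f o n) (g o n)).
Proof.
  intros Hf Hg; unfold tln.
  apply (comp_prec f (fun _ _ _ a => psnd (pred a))); try assumption.
  apply comp_snd, comp_pred; repeat comp_basic.
Qed.

Lemma comp_plen f : comp f -> comp (fun o n => plen (f o n)).
Proof.
  intros Hf; apply (comp_app (fun _ w => plen w)); [|exact Hf]; unfold plen.
  apply (comp_bsum (fun _ w j => 1 - (1 - tln w j))); [|comp_basic].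
  repeat apply comp_sub; repeat comp_basic; apply comp_tln; repeat comp_basic.
Qed.

Lemma comp_ptake f g : comp f -> comp g -> comp (fun o n => ptake (f o n) (g o n)).
Proof.
  intros Hf Hg; unfold ptake; apply comp_tln; [exact Hf|].
  apply comp_sub; [now apply comp_plen|exact Hg].
Qed.

Lemma comp_pnth f g : comp f -> comp g -> comp (fun o n => pnth (f o n) (g o n)).
Proof.
  intros Hf Hg; unfold pnth; apply comp_fst, comp_pred, comp_ptake; [exact Hf|].
  now apply comp_S.
Qed.

Lemma tln_S w i : tln w (S i) = psnd (pred (tln w i)).
Proof. reflexivity. Qed.

Lemma tln_prefix o k i : tln (prefix o k) i = prefix o (k - i).
Proof.
  induction i as [|i IH]; [now rewrite Nat.sub_0_r|].
  rewrite tln_S, IH; destruct (k - i) as [|m] eqn:E.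
  - replace (k - S i) with 0 by lia; reflexivity.
  - replace (k - S i) with m by lia; simpl; apply psnd_npair.
Qed.

Lemma prefix_ge o k : k <= prefix o k.
Proof.
  induction k as [|k IH]; simpl; [lia|].
  pose proof (npair_ge (o k) (prefix o k)); lia.
Qed.

Lemma prefix_nonzero o k : 0 < k -> prefix o k <> 0.
Proof. destruct k; simpl; lia. Qed.

Lemma plen_prefix o k : plen (prefix o k) = k.
Proof.
  unfold plen, bsum.
  assert (H : forall b, prec 0 (fun j a => 1 - (1 - tln (prefix o k) j) + a) b
                        = Nat.min b k).
  { induction b as [|b IH]; [reflexivity|]; cbn [prec]; rewrite IH, tln_prefix.
    destruct (le_lt_dec k b) as [L|L].
    - replace (k - b) with 0 by lia; simpl prefix; lia.
    - pose proof (prefix_nonzero o (k - b) ltac:(lia)); lia. }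
  rewrite H; pose proof (prefix_ge o k); lia.
Qed.

Lemma ptake_prefix o k j : j <= k -> ptake (prefix o k) j = prefix o j.
Proof.
  intros Hj; unfold ptake; rewrite plen_prefix, tln_prefix; f_equal; lia.
Qed.

Lemma pnth_prefix o k i : i < k -> pnth (prefix o k) i = o i.
Proof.
  intros Hi; unfold pnth; rewrite ptake_prefix by lia; simpl; apply pfst_npair.
Qed.

Lemma prefix_ext o o' k : agree k o o' -> prefix o k = prefix o' k.
Proof.
  induction k as [|k IH]; intros H; [reflexivity|]; simpl.
  rewrite (H k) by lia; rewrite IH; [reflexivity|]; intros i Hi; apply H; lia.
Qed.

(** Stripping the outermost entry decreases the code. As every number is thus a word, quantifiers
    over words are quantifiers over numbers. *)
Lemma prefix_surj w : exists o k, w = prefix o k.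
Proof.
  induction w as [w IH] using lt_wf_ind; destruct w as [|m].
  - exists zero_oracle, 0; reflexivity.
  - destruct (IH (psnd m)) as (o & k & E); [pose proof (psnd_le m); lia|].
    exists (fun i => if Nat.eq_dec i k then pfst m else o i), (S k); simpl.
    destruct (Nat.eq_dec k k) as [_|]; [|lia].
    rewrite <- (npair_eta m) at 1; f_equal; f_equal; rewrite E.
    apply prefix_ext; intros i Hi; destruct (Nat.eq_dec i k); [lia|reflexivity].
Qed.

Lemma prefix_pnth w : prefix (pnth w) (plen w) = w.
Proof.
  destruct (prefix_surj w) as (o & k & ->); rewrite plen_prefix.
  apply prefix_ext; intros i Hi; now apply pnth_prefix.
Qed.

Lemma prefix_plen_agree o w k : prefix o k = w -> k = plen w /\ agree k o (pnth w).
Proof.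
  intros <-; split; [now rewrite plen_prefix|].
  intros i Hi; now rewrite pnth_prefix.
Qed.

Lemma prefix_is o w : agree (plen w) o (pnth w) -> prefix o (plen w) = w.
Proof. intros H; rewrite (prefix_ext _ _ _ H); apply prefix_pnth. Qed.

Lemma ptake_le w j : j <= plen w -> ptake w j = prefix (pnth w) j.
Proof.
  intros Hj; rewrite <- (ptake_prefix (pnth w) (plen w)) by exact Hj.
  now rewrite prefix_pnth.
Qed.

Lemma comp_prefix (F : baire -> nat -> baire) k :
  comp (fun o c => F o (pfst c) (psnd c)) -> comp k ->
  comp (fun o n => prefix (F o n) (k o n)).
Proof.
  intros HF Hk.
  apply (comp_ext (fun o n =>
    prec 0 (fun j a => S (npair (F o n j) a)) (k o n))).
  - intros o n; induction (k o n) as [|j IH]; simpl; [|rewrite IH]; reflexivity.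
  - apply (comp_prec (fun _ _ => 0) (fun o n j a => S (npair (F o n j) a)));
      [comp_basic| |exact Hk].
    apply comp_S, comp_pair; [|repeat comp_basic].
    apply (comp_app2 F); [exact HF| |]; repeat comp_basic.
Qed.

Ltac solve_comp :=
  cbv beta;
  first [assumption | simple apply comp_const | lazymatch goal with
  | |- comp (fun o n => n) => apply comp_id
  | |- comp (fun o n => pfst _) => apply comp_fst; solve_comp
  | |- comp (fun o n => psnd _) => apply comp_snd; solve_comp
  | |- comp (fun o n => S _) => apply comp_S; solve_comp
  | |- comp (fun o n => npair _ _) => apply comp_pair; solve_comp
  | |- comp (fun o n => o _) => apply comp_oracle; solve_comp
  | |- comp (fun o n => pred _) => apply comp_pred; solve_comp
  | |- comp (fun o n => _ + _) => apply comp_add; solve_comp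
  | |- comp (fun o n => _ - _) => apply comp_sub; solve_comp
  | |- comp (fun o n => tln _ _) => apply comp_tln; solve_comp
  | |- comp (fun o n => plen _) => apply comp_plen; solve_comp
  | |- comp (fun o n => ptake _ _) => apply comp_ptake; solve_comp
  | |- comp (fun o n => pnth _ _) => apply comp_pnth; solve_comp
  | |- comp (fun o n => if decide _ then _ else _) =>
      apply comp_if; [solve_dec|solve_comp|solve_comp]
  | |- comp (fun o n => prefix (@?F o n) (@?k o n)) =>
      apply (comp_prefix F k); solve_comp
  | H : comp (fun o c => ?F o (pfst c) (psnd c))
    |- comp (fun o n => ?F o (@?f o n) (@?g o n)) =>
      apply (comp_app2 F f g H); solve_comp
  | H : comp (fun o c => ?F (pfst c) (psnd c))
    |- comp (fun o n => ?F (@?f o n) (@?g o n)) =>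
      apply (comp_app2 (fun _ => F) f g H); solve_comp
  | H : comp ?F |- comp (fun o n => ?F o (@?f o n)) =>
      apply (comp_app F f H); solve_comp
  | H : comp (fun _ n => ?F n) |- comp (fun o n => ?F (@?f o n)) =>
      apply (comp_app (fun _ => F) f H); solve_comp
  | _ => idtac
  end]
with solve_dec :=
  cbv beta;
  first [assumption | lazymatch goal with
  | |- dec (fun o n => _ = _) => apply dec_eq; solve_comp
  | |- dec (fun o n => _ <= _) => apply dec_le; solve_comp
  | |- dec (fun o n => _ < _) => apply dec_lt; solve_comp
  | |- dec (fun o n => _ /\ _) => apply dec_and; solve_dec
  | |- dec (fun o n => _ \/ _) => apply dec_or; solve_dec
  | |- dec (fun o n => ~ _) => apply dec_not; solve_dec
  | |- dec (fun o n => forall i, i < @?k o n -> @?P o n i) =>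
      apply (dec_ball P k); [solve_dec|solve_comp]
  | |- dec (fun o n => exists i, i < @?k o n /\ @?P o n i) =>
      apply (dec_bex P k); [solve_dec|solve_comp]
  | |- dec (fun o n => @?P o n -> @?Q o n) => apply (dec_imp P Q); solve_dec
  | H : dec (fun o c => ?P o (pfst c) (psnd c))
    |- dec (fun o n => ?P o (@?f o n) (@?g o n)) =>
      apply (dec_app2 P f g H); solve_comp
  | H : dec (fun o c => ?P (pfst c) (psnd c))
    |- dec (fun o n => ?P (@?f o n) (@?g o n)) =>
      apply (dec_app2 (fun _ => P) f g H); solve_comp
  | H : dec ?P |- dec (fun o n => ?P o (@?f o n)) =>
      apply (dec_app P f H); solve_comp
  | H : dec (fun _ n => ?P n) |- dec (fun o n => ?P (@?f o n)) =>
      apply (dec_app (fun _ => P) f H); solve_comp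
  | _ => idtac
  end].

(** * Semidecidable predicates *)

(** The decidable kernel [D] sees only a finite prefix of the oracle, so effectivity comes together
    with finite use of the oracle. *)
Definition semi (P : baire -> nat -> Prop) : Prop :=
  exists D : nat -> Prop, dec (fun _ n => D n) /\
    forall o n, P o n <-> exists k, D (npair n (prefix o k)).

Lemma semi_ext P Q : (forall o n, P o n <-> Q o n) -> semi P -> semi Q.
Proof. intros E [D [HD HP]]; exists D; split; [exact HD|]; intros; now rewrite <- E. Qed.

Lemma semi_dec_plain (D : nat -> Prop) : dec (fun _ n => D n) -> semi (fun _ n => D n).
Proof.
  intros HD; exists (fun c => D (pfst c)); split; [solve_dec|].
  intros o n; setoid_rewrite pfst_npair; split; [now exists 0|now intros [_ H]].
Qed.

Lemma semi_and P Q : semi P -> semi Q -> semi (fun o n => P o n /\ Q o n).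
Proof.
  intros [D [HD HP]] [D' [HD' HQ]].
  (* Since [D] and [D'] are not assumed monotone in the prefix, both are tested on all initial
     segments of one common prefix. *)
  exists (fun c =>
    (exists i, i < S (plen (psnd c)) /\ D (npair (pfst c) (ptake (psnd c) i))) /\
    (exists i, i < S (plen (psnd c)) /\ D' (npair (pfst c) (ptake (psnd c) i)))).
  split; [solve_dec|].
  intros o n; rewrite HP, HQ.
  setoid_rewrite psnd_npair; setoid_rewrite pfst_npair; setoid_rewrite plen_prefix.
  split.
  - intros [[k Hk] [k' Hk']]; exists (k + k'); split; [exists k|exists k'];
      (split; [lia|]); rewrite ptake_prefix by lia; assumption.
  - intros [k [[i [Hi H]] [j [Hj H']]]].
    rewrite ptake_prefix in H by lia; rewrite ptake_prefix in H' by lia; eauto.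
Qed.

Lemma semi_or P Q : semi P -> semi Q -> semi (fun o n => P o n \/ Q o n).
Proof.
  intros [D [HD HP]] [D' [HD' HQ]].
  exists (fun c => D c \/ D' c); split; [solve_dec|].
  intros o n; rewrite HP, HQ; split.
  - intros [[k Hk]|[k Hk]]; exists k; tauto.
  - intros [k [Hk|Hk]]; eauto.
Qed.

Lemma semi_ex P : semi (fun o c => P o (pfst c) (psnd c)) ->
  semi (fun o n => exists i, P o n i).
Proof.
  intros [D [HD HP]].
  (* The length of the prefix bounds both the witness [i] and the initial segment that confirms
     it. *)
  exists (fun c => exists i, i < S (plen (psnd c)) /\
    exists j, j < S (plen (psnd c)) /\
      D (npair (npair (pfst c) i) (ptake (psnd c) j))).
  split; [solve_dec|].
  intros o n.
  setoid_rewrite psnd_npair; setoid_rewrite pfst_npair; setoid_rewrite plen_prefix.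
  split.
  - intros [i Hi]; specialize (HP o (npair n i)).
    rewrite pfst_npair, psnd_npair in HP; apply HP in Hi; destruct Hi as [k Hk].
    exists (i + k), i; split; [lia|]; exists k; split; [lia|].
    now rewrite ptake_prefix by lia.
  - intros (k & i & Hi & j & Hj & H); rewrite ptake_prefix in H by lia.
    exists i; specialize (HP o (npair n i)); rewrite pfst_npair, psnd_npair in HP.
    apply HP; eauto.
Qed.

Lemma bounded_collection (P : nat -> nat -> Prop) b :
  (forall i, i < b -> exists k, P i k) ->
  exists K, forall i, i < b -> exists k, k <= K /\ P i k.
Proof.
  induction b as [|b IH]; intros H; [exists 0; intros; lia|].
  destruct IH as [K HK]; [intros; apply H; lia|].
  destruct (H b ltac:(lia)) as [k Hk]; exists (K + k); intros i Hi.
  destruct (Nat.eq_dec i b) as [->|]; [exists k; split; [lia|exact Hk]|].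
  destruct (HK i ltac:(lia)) as [k' [? ?]]; exists k'; split; [lia|assumption].
Qed.

(* Before [semi_eval] only oracle-free functions are known to have semidecidable
   graphs, whence the restricted versions of the closure lemmas. *)
Lemma semi_ball_plain P (b : nat -> nat) : comp (fun _ n => b n) ->
  semi (fun o c => P o (pfst c) (psnd c)) ->
  semi (fun o n => forall i, i < b n -> P o n i).
Proof.
  intros Hb [D [HD HP]].
  exists (fun c => forall i, i < b (pfst c) ->
    exists j, j < S (plen (psnd c)) /\
      D (npair (npair (pfst c) i) (ptake (psnd c) j))).
  split; [solve_dec|].
  assert (HP' : forall o n i, P o n i <-> exists k, D (npair (npair n i) (prefix o k))).
  { intros o n i; specialize (HP o (npair n i)).
    now rewrite pfst_npair, psnd_npair in HP. }
  intros o n.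
  setoid_rewrite psnd_npair; setoid_rewrite pfst_npair; setoid_rewrite plen_prefix.
  setoid_rewrite HP'; split.
  - intros H; apply bounded_collection in H; destruct H as [K HK].
    exists K; intros i Hi; destruct (HK i Hi) as (k & Hk & H).
    exists k; split; [lia|]; now rewrite ptake_prefix by lia.
  - intros [k H] i Hi; destruct (H i Hi) as (j & Hj & Hd).
    rewrite ptake_prefix in Hd by lia; eauto.
Qed.

Lemma semi_app_plain P (f : nat -> nat) : semi P -> comp (fun _ n => f n) ->
  semi (fun o n => P o (f n)).
Proof.
  intros [D [HD HP]] Hf; exists (fun c => D (npair (f (pfst c)) (psnd c))).
  split; [solve_dec|]; intros o n.
  setoid_rewrite psnd_npair; setoid_rewrite pfst_npair; apply HP.
Qed.

Lemma semi_app2_plain P (f g : nat -> nat) :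
  semi (fun o c => P o (pfst c) (psnd c)) ->
  comp (fun _ n => f n) -> comp (fun _ n => g n) ->
  semi (fun o n => P o (f n) (g n)).
Proof.
  intros HP Hf Hg; apply (semi_ext (fun o n => P o
    (pfst (npair (f n) (g n))) (psnd (npair (f n) (g n))))).
  - intros o n; now rewrite pfst_npair, psnd_npair.
  - apply (semi_app_plain _ (fun n => npair (f n) (g n)) HP); solve_comp.
Qed.

Lemma semi_oracle_plain (f g : nat -> nat) :
  comp (fun _ n => f n) -> comp (fun _ n => g n) ->
  semi (fun o n => g n = o (f n)).
Proof.
  intros Hf Hg.
  exists (fun c => f (pfst c) < plen (psnd c) /\
                   g (pfst c) = pnth (psnd c) (f (pfst c))).
  split; [solve_dec|]; intros o n.
  setoid_rewrite psnd_npair; setoid_rewrite pfst_npair; setoid_rewrite plen_prefix.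
  split.
  - intros E; exists (S (f n)); split; [lia|]; rewrite pnth_prefix by lia; auto.
  - intros [k [Hk E]]; now rewrite pnth_prefix in E by lia.
Qed.

Ltac semi_plain :=
  cbv beta;
  lazymatch goal with
  | |- semi (fun o n => exists i, @?P o n i) => apply (semi_ex P); semi_plain
  | |- semi (fun o n => _ /\ _) => apply semi_and; semi_plain
  | |- semi (fun o n => _ \/ _) => apply semi_or; semi_plain
  | |- semi (fun o n => _ = o _) => apply semi_oracle_plain; solve_comp
  | |- semi (fun o n => forall i, i < @?b n -> @?P o n i) =>
      apply (semi_ball_plain P b); [solve_comp|semi_plain]
  | H : semi (fun o c => ?P o (pfst c) (psnd c))
    |- semi (fun o n => ?P o (@?f n) (@?g n)) =>
      apply (semi_app2_plain P f g H); solve_comp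
  | |- semi (fun _ n => @?D n) => apply (semi_dec_plain D); solve_dec
  end.

(** A halting computation is a finite object that reads finitely many oracle values; the induction
    on programs guesses its intermediate values. *)
Lemma semi_eval e : semi (fun o c => eval e o (pfst c) (psnd c)).
Proof.
  induction e; simpl.
  - semi_plain.
  - semi_plain.
  - semi_plain.
  - semi_plain.
  - semi_plain.
  - set (V1 := eval e1) in *; set (V2 := eval e2) in *; clearbody V1 V2; semi_plain.
  - set (V1 := eval e1) in *; set (V2 := eval e2) in *; clearbody V1 V2; semi_plain.
  - set (V1 := eval e1) in *; set (V2 := eval e2) in *; clearbody V1 V2.
    (* The history of a recursion matters only up to the last round, so a finite word replaces the
       sequence [h]. *)
    apply (semi_ext (fun o c => exists w,
      V1 o (pfst (pfst c)) (pnth w 0) /\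
      (forall j, j < psnd (pfst c) -> V2 o
         (npair (pfst (pfst c)) (npair j (pnth w j))) (pnth w (S j))) /\
      psnd c = pnth w (psnd (pfst c)))); [|semi_plain].
    intros o c; split.
    + intros (w & H); exists (pnth w); exact H.
    + intros (h & H0 & HS & E); exists (prefix h (S (psnd (pfst c)))).
      split; [now rewrite pnth_prefix by lia|split].
      * intros j Hj; rewrite !pnth_prefix by lia; auto.
      * now rewrite pnth_prefix by lia.
  - set (V1 := eval e) in *; clearbody V1; semi_plain.
Qed.

(** Running both programs is semidecidable by [semi_eval], which lifts the restriction to
    oracle-free functions. *)
Lemma semi_eq f g : comp f -> comp g -> semi (fun o n => f o n = g o n).
Proof.
  intros [e He] [e' He'].
  apply (semi_ext (fun o n => exists m, eval e o n m /\ eval e' o n m)).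
  - intros o n; setoid_rewrite He; setoid_rewrite He'; split.
    + intros (m & -> & E); exact E.
    + intros E; exists (f o n); auto.
  - pose proof (semi_eval e); pose proof (semi_eval e').
    set (V1 := eval e) in *; set (V2 := eval e') in *; clearbody V1 V2; semi_plain.
Qed.

Lemma semi_dec P : dec P -> semi P.
Proof.
  intros [f [Hf HP]]; apply (semi_ext (fun o n => f o n = 0)).
  - intros; now rewrite HP.
  - apply semi_eq; [exact Hf|solve_comp].
Qed.

Lemma semi_app P f : semi P -> comp f -> semi (fun o n => P o (f o n)).
Proof.
  intros HP Hf; apply (semi_ext (fun o n => exists m, f o n = m /\ P o m)).
  - intros o n; split; [intros (m & <- & H); exact H|eauto].
  - apply (semi_ex (fun o n m => f o n = m /\ P o m)), semi_and.
    + apply semi_eq; solve_comp.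
    + apply (semi_app_plain P psnd HP); solve_comp.
Qed.

Lemma semi_app2 P f g : semi (fun o c => P o (pfst c) (psnd c)) ->
  comp f -> comp g -> semi (fun o n => P o (f o n) (g o n)).
Proof.
  intros HP Hf Hg; apply (semi_ext (fun o n => P o
    (pfst (npair (f o n) (g o n))) (psnd (npair (f o n) (g o n))))).
  - intros o n; now rewrite pfst_npair, psnd_npair.
  - exact (semi_app _ _ HP (comp_pair _ _ Hf Hg)).
Qed.

Lemma semi_ball P b : semi (fun o c => P o (pfst c) (psnd c)) -> comp b ->
  semi (fun o n => forall i, i < b o n -> P o n i).
Proof.
  intros HP Hb.
  apply (semi_ext (fun o n => exists k, b o n = k /\ forall i, i < k -> P o n i)).
  - intros o n; split; [intros (k & <- & H); exact H|eauto].
  - apply (semi_ex (fun o n k => b o n = k /\ forall i, i < k -> P o n i)), semi_and.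
    + apply semi_eq; solve_comp.
    + apply (semi_ball_plain (fun o c i => P o (pfst c) i) psnd); [solve_comp|].
      apply (semi_app2_plain P (fun c => pfst (pfst c)) psnd HP); solve_comp.
Qed.

Lemma semi_eval_app e f g : comp f -> comp g ->
  semi (fun o n => eval e o (f o n) (g o n)).
Proof. exact (semi_app2 (eval e) f g (semi_eval e)). Qed.

Ltac solve_semi :=
  cbv beta;
  first [assumption | lazymatch goal with
  | |- semi (fun o n => exists i, @?P o n i) => apply (semi_ex P); solve_semi
  | |- semi (fun o n => _ /\ _) => apply semi_and; solve_semi
  | |- semi (fun o n => _ \/ _) => apply semi_or; solve_semi
  | |- semi (fun o n => _ = _) => apply semi_eq; solve_comp
  | |- semi (fun o n => _ <= _) => apply semi_dec; solve_dec
  | |- semi (fun o n => _ < _) => apply semi_dec; solve_dec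
  | |- semi (fun o n => forall i, i < @?b o n -> @?P o n i) =>
      apply (semi_ball P b); [solve_semi|solve_comp]
  | |- semi (fun o n => eval ?e o _ _) => apply (semi_eval_app e); solve_comp
  | H : semi (fun o c => ?P o (pfst c) (psnd c))
    |- semi (fun o n => ?P o (@?f o n) (@?g o n)) =>
      apply (semi_app2 P f g H); solve_comp
  | H : semi (fun o c => ?P (pfst c) (psnd c))
    |- semi (fun o n => ?P (@?f o n) (@?g o n)) =>
      apply (semi_app2 (fun _ => P) f g H); solve_comp
  | H : semi ?P |- semi (fun o n => ?P o (@?f o n)) =>
      apply (semi_app P f H); solve_comp
  | H : semi (fun _ n => ?P n) |- semi (fun o n => ?P (@?f o n)) =>
      apply (semi_app (fun _ => P) f H); solve_comp
  | |- _ => apply semi_dec; solve_dec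
  end].

(** * Functionals *)

Definition cfun (F : baire -> nat -> baire) : Prop :=
  comp (fun o c => F o (pfst c) (psnd c)).

Definition graph_at (G : baire -> nat -> Prop) (o : baire) (n : nat) (q : baire) : Prop :=
  forall i v, G o (npair n (npair i v)) <-> v = q i.

(** [P] reads a finite word of [q], which can be guessed and checked entry by entry against the
    graph. Hence [q] may come from a partial functional, for instance a program that converges only
    on names. *)
Lemma semi_sub G P : semi G -> semi P ->
  exists P', semi P' /\ forall o n q, graph_at G o n q -> (P' o n <-> P q n).
Proof.
  intros HG [D [HD HP]].
  exists (fun o n => exists w,
    (forall i, i < plen w -> G o (npair n (npair i (pnth w i)))) /\ D (npair n w)).
  split; [solve_semi|].
  intros o n q Hq; rewrite HP; split.
  - intros (w & Hw & Hd); exists (plen w).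
    replace (prefix q (plen w)) with w; [exact Hd|].
    symmetry; apply prefix_is; intros i Hi; symmetry; apply Hq; auto.
  - intros [k Hd]; exists (prefix q k); split; [|exact Hd].
    rewrite plen_prefix; intros i Hi; apply Hq; now rewrite pnth_prefix.
Qed.

Lemma graph_cfun F : cfun F ->
  exists G, semi G /\ forall o n, graph_at G o n (F o n).
Proof.
  intros HF; exists (fun o c => psnd (psnd c) = F o (pfst c) (pfst (psnd c))).
  split; [unfold cfun in HF; solve_semi|].
  intros o n i v; cbv beta; now rewrite !psnd_npair, !pfst_npair.
Qed.

Lemma semi_cfun P F : semi P -> cfun F -> semi (fun o n => P (F o n) n).
Proof.
  intros HP HF; destruct (graph_cfun F HF) as (G & HG & Hgr).
  destruct (semi_sub G P HG HP) as (P' & HP' & H).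
  apply (semi_ext P'); [|exact HP']; intros o n; apply H, Hgr.
Qed.

Lemma graph_run e F : cfun F -> exists G, semi G /\
  forall o n q, run e (F o n) q -> graph_at G o n q.
Proof.
  intros HF.
  exists (fun o c => eval e (F o (pfst c)) (pfst (psnd c)) (psnd (psnd c))).
  split.
  - apply (semi_cfun (fun q c => eval e q (pfst (psnd c)) (psnd (psnd c)))
      (fun o c => F o (pfst c))); [solve_semi|].
    unfold cfun in *; solve_comp.
  - intros o n q Hq i v; cbv beta; rewrite !psnd_npair, !pfst_npair.
    split; [intros H; exact (eval_fun _ _ _ _ _ H (Hq i))|intros ->; apply Hq].
Qed.

(** Effective uniformization: [Min] finds the least pair of a value and a prefix length that
    confirms it, and the first component is returned. *)
Lemma semi_select G : semi G -> exists e, forall o n,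
  (forall m, eval e o n m -> G o (npair n m)) /\
  ((exists m, G o (npair n m)) -> exists m, eval e o n m).
Proof.
  intros [D [HD HG]].
  assert (Hd : dec (fun o c => D (npair (npair (pfst c) (pfst (psnd c)))
                                        (prefix o (psnd (psnd c)))))) by solve_dec.
  destruct Hd as [f [[ef Hf] Hd]].
  exists (Comp Fst (Min ef)); intros o n; split.
  - intros m (j & [Hj _] & ->); apply Hf in Hj; symmetry in Hj; apply Hd in Hj.
    rewrite psnd_npair, pfst_npair in Hj; apply HG; eauto.
  - intros [m Hm]; apply HG in Hm; destruct Hm as [k Hk].
    assert (Hex : exists j, f o (npair n j) = 0).
    { exists (npair m k); apply Hd; now rewrite !psnd_npair, !pfst_npair. }
    destruct Hex as [j Hj]; revert Hj; induction j as [j IH] using lt_wf_ind.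
    intros Hj.
    destruct (classic (exists i, i < j /\ f o (npair n i) = 0)) as [(i & Hi & E)|N].
    { exact (IH i Hi E). }
    exists (pfst j), j; split; [split|reflexivity].
    + now apply Hf.
    + intros i Hi; exists (pred (f o (npair n i))); apply Hf.
      destruct (f o (npair n i)) eqn:E; [destruct N; eauto|reflexivity].
Qed.

Lemma run_comp F : comp F -> exists e, forall o, run e o (F o).
Proof. intros [e He]; exists e; intros o n; now apply He. Qed.

(** Each oracle query becomes a call to [r], so composition of functionals is a substitution in
    programs. *)
Fixpoint psub (e r : prog) : prog :=
  match e with
  | Oracle => r
  | Pair f g => Pair (psub f r) (psub g r)
  | Comp f g => Comp (psub f r) (psub g r)
  | Rec f g => Rec (psub f r) (psub g r)
  | Min f => Min (psub f r)
  | e => e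
  end.

Lemma eval_psub e r o p n m :
  run r o p -> eval e p n m -> eval (psub e r) o n m.
Proof.
  intros Hr; revert n m; induction e; simpl; intros n m H; auto.
  - subst m; apply Hr.
  - destruct H as (a & b & Ha & Hb & ->); exists a, b; auto.
  - destruct H as (a & Ha & Hb); exists a; auto.
  - destruct H as (h & H0 & HS & ->); exists h; auto.
  - destruct H as (H0 & HS); split; [auto|].
    intros j Hj; destruct (HS j Hj) as [b Hb]; eauto.
Qed.

Lemma run_psub e r o p q : run r o p -> run e p q -> run (psub e r) o q.
Proof. intros Hr He n; exact (eval_psub _ _ _ _ _ _ Hr (He n)). Qed.

Lemma ce_iff A : ce A <-> semi (fun _ n => A n).
Proof.
  split.
  - intros [e He]; apply (semi_ext (fun _ n => exists m, eval e zero_oracle n m)).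
    { intros _ n; now rewrite He. }
    apply (semi_cfun (fun q n => exists m, eval e q n m) (fun _ _ => zero_oracle)).
    + solve_semi.
    + unfold cfun, zero_oracle; solve_comp.
  - intros HA.
    destruct (semi_select (fun _ c => A (pfst c))) as [e He]; [solve_semi|].
    exists e; intros n; destruct (He zero_oracle n) as [H1 H2].
    setoid_rewrite pfst_npair in H1; setoid_rewrite pfst_npair in H2; split.
    + intros Hn; apply H2; now exists 0.
    + intros [m Hm]; exact (H1 m Hm).
Qed.

Lemma ce_rel_iff R : ce_rel R <-> semi (fun _ c => R (pfst c) (psnd c)).
Proof. apply ce_iff. Qed.

(** Substituting [Zero] for oracle queries makes the program give the same output at every
    oracle. *)
Lemma computable_seq_comp q : computable_seq q -> comp (fun _ n => q n).
Proof.
  intros [e He]; exists (psub e Zero); intros o n m.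
  assert (H : run (psub e Zero) o q).
  { apply (run_psub _ _ _ zero_oracle); [|exact He]; intros i; reflexivity. }
  split; [intros Hm; exact (eval_fun _ _ _ _ _ Hm (H n))|intros ->; apply H].
Qed.

Lemma computable_seq_cfun F n : cfun F -> computable_seq (F zero_oracle n).
Proof.
  intros HF; unfold cfun in HF.
  destruct (run_comp (fun o i => F o n i)) as [e He]; [solve_comp|].
  exists e; apply He.
Qed.

(** Position [npair n k] lists [n] if the prefix of length [k] confirms it and is blank otherwise;
    this procedure is total for every oracle. *)
Lemma run_enumeration P : semi P -> exists e, forall o, exists q,
  run e o q /\ forall n, P o n <-> exists k, q k = S n.
Proof.
  intros [D [HD HP]].
  destruct (run_comp (fun o c =>
    if decide (D (npair (pfst c) (prefix o (psnd c)))) then S (pfst c) else 0))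
    as [e He]; [solve_comp|].
  exists e; intros o; eexists; split; [apply He|]; intros n; rewrite HP; split.
  - intros [k Hk]; exists (npair n k); rewrite pfst_npair, psnd_npair.
    destruct (decide _); tauto.
  - intros [k Hk]; exists (psnd k); destruct (decide _); [|discriminate].
    injection Hk as <-; assumption.
Qed.

Lemma run_continuous e p q n : run e p q -> exists k, forall p' q',
  run e p' q' -> agree k p p' -> q' n = q n.
Proof.
  intros H; destruct (semi_eval e) as [D [HD He]].
  specialize (H n); specialize (He p (npair n (q n))) as Hp.
  rewrite pfst_npair, psnd_npair in Hp; apply Hp in H; destruct H as [k Hk].
  exists k; intros p' q' H' Hag; rewrite (prefix_ext _ _ _ Hag) in Hk.
  specialize (He p' (npair n (q n))); rewrite pfst_npair, psnd_npair in He.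
  refine (eval_fun _ _ _ _ _ (H' n) _); apply He; eauto.
Qed.

(** * Pairs of oracles *)

Definition join (a b : baire) : baire := fun c =>
  if decide (pfst c = 0) then a (psnd c) else b (psnd c).
Definition lft (o : baire) : baire := fun i => o (npair 0 i).
Definition rgt (o : baire) : baire := fun i => o (npair 1 i).

Lemma lft_join a b : lft (join a b) = a.
Proof.
  apply functional_extensionality; intros i; unfold lft, join.
  rewrite psnd_npair, pfst_npair; destruct (decide _); [reflexivity|lia].
Qed.

Lemma rgt_join a b : rgt (join a b) = b.
Proof.
  apply functional_extensionality; intros i; unfold rgt, join.
  rewrite psnd_npair, pfst_npair; destruct (decide _); [lia|reflexivity].
Qed.

Lemma join_agree k a b b' : agree k b b' -> agree k (join a b) (join a b').
Proof.
  intros H i Hi; unfold join; destruct (decide _); [reflexivity|].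
  apply H; pose proof (psnd_le i); lia.
Qed.

Definition semi2 (P : baire -> baire -> nat -> Prop) : Prop :=
  semi (fun o n => P (lft o) (rgt o) n).

Lemma semi2_sub G1 G2 P : semi G1 -> semi G2 -> semi2 P ->
  exists P', semi P' /\ forall o n a b,
    graph_at G1 o n a -> graph_at G2 o n b -> (P' o n <-> P a b n).
Proof.
  intros HG1 HG2 HP.
  destruct (semi_sub (fun o c =>
     (pfst (pfst (psnd c)) = 0 /\
        G1 o (npair (pfst c) (npair (psnd (pfst (psnd c))) (psnd (psnd c))))) \/
     (pfst (pfst (psnd c)) <> 0 /\
        G2 o (npair (pfst c) (npair (psnd (pfst (psnd c))) (psnd (psnd c))))))
     (fun o n => P (lft o) (rgt o) n))
    as (P' & HP' & H); [solve_semi|exact HP|].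
  exists P'; split; [exact HP'|]; intros o n a b Ha Hb.
  rewrite (H o n (join a b)), lft_join, rgt_join; [reflexivity|].
  intros i v; cbv beta; rewrite !psnd_npair, !pfst_npair, (Ha _ v), (Hb _ v).
  unfold join; destruct (decide _); tauto.
Qed.

Lemma semi2_cfun A B P : semi2 P -> cfun A -> cfun B ->
  semi (fun o n => P (A o n) (B o n) n).
Proof.
  intros HP HA HB.
  destruct (graph_cfun A HA) as (G1 & HG1 & H1).
  destruct (graph_cfun B HB) as (G2 & HG2 & H2).
  destruct (semi2_sub G1 G2 P HG1 HG2 HP) as (P' & HP' & H).
  apply (semi_ext P'); [|exact HP']; intros o n; apply H; auto.
Qed.

(** * Names of open sets *)

(** For output symbol [t] the machine reads [t] input symbols and then answers 2 or 1, meaning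
    symbol 1 or 0, according to the kernel [D]. So the output is nonzero iff some prefix confirms
    membership. The parameters [o] and [n] make the names uniform. *)
Lemma names_open_intro P (X : repspace) : semi2 P ->
  exists F, cfun F /\ forall o n (U : OpenSets X),
    (forall p x, names (rep X) p x -> (P o p n <-> in_open X x U)) ->
    names (rep (OpenSets X)) (F o n) U.
Proof.
  intros [D [HD HP]].
  exists (fun o n c => if decide (plen (psnd c) < pfst c) then 0 else
    if decide (D (npair n (prefix (join o (pnth (psnd c))) (pfst c))))
    then 2 else 1).
  split; [unfold cfun, join; solve_comp|].
  intros o n U HU p x Hp _.
  exists (fun t => if decide (D (npair n (prefix (join o p) t))) then 1 else 0),
    (in_open X x U).
  split; [|split; [|reflexivity]].
  - intros t; exists t; split.
    + rewrite psnd_npair, pfst_npair, plen_prefix.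
      rewrite (prefix_ext _ (join o p) t).
      2: { apply join_agree; intros i Hi; now apply pnth_prefix. }
      destruct (decide (t < t)); [lia|].
      destruct (decide _); reflexivity.
    + intros j Hj; rewrite psnd_npair, pfst_npair, plen_prefix.
      destruct (decide _); [reflexivity|lia].
  - change (~ in_open X x U <->
      (fun t => if decide (D (npair n (prefix (join o p) t))) then 1 else 0)
      = zero_oracle).
    rewrite <- (HU p x Hp).
    specialize (HP (join o p) n); rewrite lft_join, rgt_join in HP; rewrite HP.
    split.
    + intros H; apply functional_extensionality; intros t.
      destruct (decide _); [destruct H; eauto|reflexivity].
    + intros E [k Hk]; apply (f_equal (fun f => f k)) in E; cbv beta in E.
      destruct (decide _); [discriminate E|tauto].
Qed.

(** The universal machine with oracle [a] finds out from the finite sequence [s]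
    that it belongs to the open set named by [a]. *)
Definition verif (a : baire) (s : nat) : Prop :=
  exists t, 1 < a (npair t s) /\ forall j, j < plen s -> 0 = a (npair t (ptake s j)).

Definition memb (a p : baire) : Prop := exists k, verif a (prefix p k).

Lemma semi_verif : semi verif.
Proof. unfold verif; solve_semi. Qed.

Lemma semi2_memb : semi2 (fun a p _ => memb a p).
Proof. unfold semi2, memb, verif, lft, rgt; solve_semi. Qed.

(** The first nonzero answer about symbol [t] fixes that symbol, and an answer above 1 makes it
    nonzero; so verifications correspond to the nonzero symbols of the output. *)
Lemma memb_iff (X : repspace) a U p x :
  names (rep (OpenSets X)) a U -> names (rep X) p x ->
  (memb a p <-> in_open X x U).
Proof.
  intros Ha Hp; destruct (Ha p x Hp (ex_intro _ _ eq_refl)) as (q & y & Hq & Hy & E).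
  unfold graph in E; subst y; simpl in Hy; unfold in_open; split.
  - intros (k & t & Ht & Hj); apply NNPP; intros N; apply Hy in N; subst q.
    destruct (Hq t) as (k' & Hk' & Hj'); unfold zero_oracle in Hk'.
    rewrite plen_prefix in Hj.
    destruct (lt_eq_lt_dec k k') as [[L|L]|L].
    + specialize (Hj' _ L); lia.
    + subst k'; lia.
    + specialize (Hj _ L); rewrite ptake_prefix in Hj by lia; lia.
  - intros Hx; apply NNPP; intros N.
    assert (E : q = zero_oracle); [|apply Hy in E; exact (E Hx)].
    apply functional_extensionality; intros t; apply NNPP; intros Ht; apply N.
    destruct (Hq t) as (k & Hk & Hj); exists k, t; rewrite Hk.
    unfold zero_oracle in Ht; split; [lia|]; rewrite plen_prefix; intros j Hjk.
    rewrite ptake_prefix by lia; symmetry; auto.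
Qed.

Lemma semi_open P (X : repspace) (U : X -> Prop) n : semi P ->
  (forall p x, names (rep X) p x -> (P p n <-> U x)) -> is_open X U.
Proof.
  intros [D [HD HP]] HU p x Hp Hx; apply (HU p x Hp), HP in Hx.
  destruct Hx as [k Hk]; exists k; intros p' x' Hp' Hag.
  apply (HU p' x' Hp'), HP; exists k; now rewrite <- (prefix_ext _ _ _ Hag).
Qed.

(** * Computable maps *)

Lemma computable_map_iff (X Y : repspace) (f : X -> Y) :
  computable_map X Y f <->
  exists e, forall p x, names (rep X) p x ->
    exists q, run e p q /\ names (rep Y) q (f x).
Proof.
  split.
  - intros (F & [e He] & HF); exists e; intros p x Hp.
    destruct (HF p x Hp (ex_intro _ _ eq_refl)) as (q & y & Hq & Hy & E).
    unfold graph in E; subst y; eauto.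
  - intros [e He]; exists (run e); split; [now exists e|].
    intros p x Hp _; destruct (He p x Hp) as (q & Hq & Hn).
    exists q, (f x); unfold graph; auto.
Qed.

Lemma computable_map_ext (X Y : repspace) (f g : X -> Y) :
  (forall x, f x = g x) -> computable_map X Y f -> computable_map X Y g.
Proof. intros E; apply functional_extensionality in E; now subst. Qed.

Lemma computable_map_comp (X Y Z : repspace) (f : X -> Y) (g : Y -> Z) :
  computable_map X Y f -> computable_map Y Z g -> computable_map X Z (fun x => g (f x)).
Proof.
  rewrite !computable_map_iff; intros [e He] [r Hr]; exists (psub r e).
  intros p x Hp; destruct (He p x Hp) as (q & Hq & Hn).
  destruct (Hr q _ Hn) as (s & Hs & Hn'); exists s; split; [|exact Hn'].
  exact (run_psub _ _ _ _ _ Hq Hs).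
Qed.

Lemma computable_map_open (X Y : repspace) (f : X -> Y) U :
  computable_map X Y f -> is_open Y U -> is_open X (fun x => U (f x)).
Proof.
  rewrite computable_map_iff; intros [e He] HU p x Hp Hx.
  destruct (He p x Hp) as (q & Hq & Hn); destruct (HU q _ Hn Hx) as [k Hk].
  (* The first [k] output symbols have a common modulus of continuity. *)
  destruct (bounded_collection (fun i j => forall p' q',
    run e p' q' -> agree j p p' -> q' i = q i) k) as [K HK].
  { intros i _; now apply run_continuous. }
  exists K; intros p' x' Hp' Hag; destruct (He p' x' Hp') as (q' & Hq' & Hn').
  apply (Hk q' _ Hn'); intros i Hi; destruct (HK i Hi) as (j & Hj & H).
  symmetry; apply (H p' q' Hq'); intros l Hl; apply Hag; lia.
Qed.

Lemma semi_lft P : semi P -> semi (fun o n => P (lft o) n).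
Proof.
  intros HP; apply (semi_cfun P (fun o _ => lft o) HP).
  unfold cfun, lft; solve_comp.
Qed.

Lemma semi_rgt P : semi P -> semi (fun o n => P (rgt o) n).
Proof.
  intros HP; apply (semi_cfun P (fun o _ => rgt o) HP).
  unfold cfun, rgt; solve_comp.
Qed.

(** * Overtness, extendability and admissibility *)

Lemma separable_overt X : effectively_separable X -> computably_overt X.
Proof.
  intros (a & Ha & Hd); apply computable_map_iff in Ha; destruct Ha as [e He].
  destruct (graph_cfun (fun o _ => o)) as (G1 & HG1 & H1);
    [unfold cfun; solve_comp|].
  (* The constant sequence [i] names [i]; the program applied to it produces a name of [a i]. *)
  destruct (graph_run e (fun _ i _ => i)) as (G2 & HG2 & H2);
    [unfold cfun; solve_comp|].
  destruct (semi2_sub G1 G2 _ HG1 HG2 semi2_memb) as (P & HP & H).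
  pose proof (semi_rgt P HP) as HP'.
  destruct (names_open_intro (fun _ u _ => exists i, P u i) (OpenSets X))
    as (F & HF & Hn).
  { apply (semi_ex (fun o _ i => P (rgt o) i)).
    apply (semi_app _ (fun _ c => psnd c) HP'); solve_comp. }
  exists (F zero_oracle 0); split; [|now apply computable_seq_cfun].
  apply Hn; intros u U Hu.
  assert (E : forall i, P u i <-> in_open X (a i) U).
  { intros i; destruct (He (fun _ => i) i eq_refl) as (q & Hq & Hqn).
    rewrite (H u i u q (H1 u i) (H2 u i q Hq)); now apply memb_iff. }
  setoid_rewrite E; unfold in_open at 2; simpl; split.
  - intros [i Hi]; eauto.
  - intros (x & Hx & _); apply (Hd (proj1_sig U) (proj2_sig U)); now exists x.
Qed.

(** A realizer of [f] lists [n] exactly when [n] is in the ideal, so these open sets are named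
    uniformly in [n]; together they recover the ideal of a point. *)
Lemma element_open (X : repspace) R (f : X -> RI R) : computable_map X (RI R) f ->
  exists F (U : nat -> OpenSets X), cfun F /\
    (forall n x, in_open X x (U n) <-> proj1_sig (f x) n) /\
    forall o n, names (rep (OpenSets X)) (F o n) (U n).
Proof.
  intros Hf; apply computable_map_iff in Hf; destruct Hf as [e He].
  assert (HP : semi (fun o n => exists i, eval e o i (S n))) by solve_semi.
  assert (E : forall p x n, names (rep X) p x ->
    ((exists i, eval e p i (S n)) <-> proj1_sig (f x) n)).
  { intros p x n Hp; destruct (He p x Hp) as (q & Hq & Hqn).
    rewrite (Hqn n); split; intros [i Hi]; exists i.
    - exact (eval_fun _ _ _ _ _ (Hq i) Hi).
    - rewrite <- Hi; apply Hq. }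
  destruct (names_open_intro (fun _ p n => exists i, eval e p i (S n)) X)
    as (F & HF & Hn); [exact (semi_rgt _ HP)|].
  assert (HU : forall n, is_open X (fun x => proj1_sig (f x) n)).
  { intros n; apply (semi_open _ X _ n HP); intros p x Hp; now apply E. }
  exists F, (fun n => exist _ _ (HU n)); split; [exact HF|split].
  - intros n x; reflexivity.
  - intros o n; apply Hn; intros p x Hp; now apply E.
Qed.

Lemma overt_extendable (X : repspace) R :
  computably_isomorphic X (RI R) -> computably_overt X -> ce (extendable R).
Proof.
  intros (f & g & Hgf & Hfg & Hf & _) (c & Hc & Hcc).
  destruct (element_open X R f Hf) as (F & U & HF & HU & Hn).
  apply computable_seq_comp in Hcc; apply ce_iff.
  apply (semi_ext (fun o n => memb c (F o n))).
  - intros o n.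
    assert (Hc' : names (rep (OpenSets (OpenSets X))) c (meets X (fun _ => True)))
      by exact Hc.
    rewrite (memb_iff _ _ _ _ _ Hc' (Hn o n)); unfold in_open at 1; simpl.
    setoid_rewrite HU; split.
    + intros (x & Hx & _); exists (proj1_sig (f x)); split; [|exact Hx].
      apply (proj2_sig (f x)).
    + intros (I & HI & Hi); exists (g (exist _ I HI)); rewrite Hfg; auto.
  - apply (semi2_cfun (fun _ _ => c) F _ semi2_memb); [|exact HF].
    unfold cfun; solve_comp.
Qed.

(** The ideal of [x] consists of the [n] for which [U n] belongs to the neighbourhood filter, so it
    can be enumerated from that filter and handed to [g]. *)
Lemma RI_admissible (X : Type) (d : representation X) R (f : X -> RI R) (g : RI R -> X) :
  (forall x, g (f x) = x) -> computable_map (RepSpace d) (RI R) f ->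
  computable_map (RI R) (RepSpace d) g -> computably_admissible d.
Proof.
  intros Hgf Hf Hg.
  destruct (element_open (RepSpace d) R f Hf) as (F & U & HF & HU & Hn).
  assert (HP : semi (fun o n => memb o (F o n))).
  { apply (semi2_cfun (fun o _ => o) F _ semi2_memb); [|exact HF].
    unfold cfun; solve_comp. }
  destruct (run_enumeration _ HP) as [e He].
  apply computable_map_iff in Hg; destruct Hg as [r Hr].
  split.
  - intros x y E; rewrite <- (Hgf x), <- (Hgf y); f_equal.
    apply sig_eq, set_ext; intros n; rewrite <- !HU.
    assert (E' : in_open (RepSpace d) x (U n) = in_open (RepSpace d) y (U n))
      by exact (f_equal (fun W : OpenSets (OpenSets (RepSpace d)) =>
                           proj1_sig W (U n)) E).
    now rewrite E'.
  - exists (run (psub r e)); split; [now exists (psub r e)|].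
    intros a W Ha [x Hx]; subst W.
    destruct (He a) as (q & Hq & Hqn).
    assert (Hq' : names (rep (RI R)) q (f x)).
    { intros n; rewrite <- HU, <- Hqn, (memb_iff _ _ _ _ _ Ha (Hn a n)).
      reflexivity. }
    destruct (Hr q _ Hq') as (p & Hp & Hpn); rewrite Hgf in Hpn.
    exists p, x; split; [exact (run_psub _ _ _ _ _ Hq Hp)|auto].
Qed.

(** * Total representations by sequences of choices *)

(** The third clause makes every successor selectable; the fourth lets every choice number lead
    somewhere once a successor exists, which is what makes the representation total. *)
Definition successor_selection (Q T : nat -> nat -> Prop) : Prop :=
  (forall c s s', T c s -> T c s' -> s = s') /\
  (forall s i s', T (npair s i) s' -> Q s s') /\
  (forall s s', Q s s' -> exists i, T (npair s i) s') /\
  (forall s s' i, Q s s' -> exists s'', T (npair s i) s'').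

(* [T (npair s i) s'] holds if [s'] is the successor of [s] found by the first
   successful stage [j >= i] of an enumeration of [Q] in which each pair shows up
   at infinitely many stages; so every [i] leads to some successor. *)
Lemma successor_selection_ex Q : semi (fun _ c => Q (pfst c) (psnd c)) ->
  exists T, successor_selection Q T /\ semi (fun _ c => T (pfst c) (psnd c)).
Proof.
  intros [D0 [HD0 HQ0]].
  set (D := fun s j => exists k, k < S (psnd j) /\
    D0 (npair (npair s (pfst j)) (prefix zero_oracle k))).
  assert (HD : dec (fun _ c => D (pfst c) (psnd c))).
  { unfold D, zero_oracle; solve_dec. }
  assert (HQ : forall s s', Q s s' <->
    exists k, D0 (npair (npair s s') (prefix zero_oracle k))).
  { intros s s'; specialize (HQ0 zero_oracle (npair s s')).
    now rewrite pfst_npair, psnd_npair in HQ0. }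
  assert (Hlate : forall s s' i, Q s s' -> exists j, i <= j /\ D s j).
  { intros s s' i H; apply HQ in H; destruct H as [k Hk].
    exists (npair s' (k + i)); split.
    - pose proof (npair_ge s' (k + i)); lia.
    - exists k; rewrite psnd_npair, pfst_npair; split; [lia|exact Hk]. }
  exists (fun c s' => exists j, psnd c <= j /\ D (pfst c) j /\
    (forall l, l < j -> psnd c <= l -> ~ D (pfst c) l) /\ s' = pfst j).
  split; [|solve_semi]; repeat split.
  - intros c s s' (j & Hij & Hj & Hl & ->) (j' & Hij' & Hj' & Hl' & ->).
    destruct (lt_eq_lt_dec j j') as [[L|L]|L]; [|now subst|].
    + destruct (Hl' j); auto.
    + destruct (Hl j'); auto.
  - intros s i s' (j & _ & (k & _ & Hk) & _ & ->); rewrite pfst_npair in Hk.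
    apply HQ; eauto.
  - intros s s' H; apply HQ in H; destruct H as [k Hk].
    (* Taking the confirming stage itself as the choice number makes it the first successful one. *)
    exists (npair s' k), (npair s' k); rewrite !psnd_npair, !pfst_npair.
    split; [lia|split; [|split; [lia|reflexivity]]].
    exists k; rewrite psnd_npair, pfst_npair; split; [lia|exact Hk].
  - intros s s' i H; setoid_rewrite psnd_npair; setoid_rewrite pfst_npair.
    destruct (Hlate s s' i H) as (j & Hij & Hj); revert Hij Hj.
    induction j as [j IH] using lt_wf_ind; intros Hij Hj.
    destruct (classic (exists l, l < j /\ i <= l /\ D s l)) as [(l & Hl & Hil & H')|N].
    { exact (IH l Hl Hil H'). }
    exists (pfst j), j; repeat split; auto.
    intros l Hl Hil H'; apply N; eauto.
Qed.

(** The state [0] is initial, and the state [S z] stands for the link [z]. *)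
Definition next (R : nat -> nat -> Prop) (s s' : nat) : Prop :=
  exists z, s' = S z /\ extendable R z /\ (s = 0 \/ exists n, s = S n /\ R n z).

Definition path (T : nat -> nat -> Prop) (p h : baire) : Prop :=
  forall k, T (npair (h k) (p k)) (h (S k)).

Definition limit (R : nat -> nat -> Prop) (h : baire) : nat -> Prop :=
  fun x => exists k z, h k = S z /\ R x z.

Lemma semi_next R : ce_rel R -> ce (extendable R) ->
  semi (fun _ c => next R (pfst c) (psnd c)).
Proof.
  rewrite ce_rel_iff, ce_iff; intros HR HE; unfold next; solve_semi.
Qed.

(** Directedness applied to [z] twice yields a larger element of the same ideal, itself extendable;
    so chains of extendable links never get stuck. *)
Lemma next_ex R s z : next R s (S z) -> exists s', next R (S z) s'.
Proof.
  intros (y & E & (I & HI & Hy) & _); injection E as <-.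
  destruct HI as [H1 [H2 H3]]; destruct (H3 z z Hy Hy) as (y & HIy & Hzy & _).
  exists (S y), y; split; [reflexivity|split; [|eauto]].
  exists I; unfold rounded_ideal; auto.
Qed.

Lemma path_ex R T s p : successor_selection (next R) T -> (exists s', next R s s') ->
  exists h, h 0 = s /\ path T p h.
Proof.
  intros (_ & HT2 & _ & HT4) Hs.
  assert (Hv : forall c, exists s', (exists y, T c y) -> T c s').
  { intros c; destruct (classic (exists y, T c y)) as [[y Hy]|N];
      [now exists y|exists 0; tauto]. }
  destruct (choice _ Hv) as [v Hv'].
  set (h := nat_rec (fun _ => nat) s (fun k a => v (npair a (p k)))).
  assert (Hh : forall k, (exists s', next R (h k) s') /\ T (npair (h k) (p k)) (h (S k))).
  { assert (St : forall k, (exists s', next R (h k) s') ->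
      T (npair (h k) (p k)) (h (S k))).
    { intros k [s' Hs']; simpl; apply Hv'; exact (HT4 _ _ _ Hs'). }
    induction k as [|k [IH1 IH2]]; [auto|].
    assert (E : exists s', next R (h (S k)) s'); [|auto].
    apply HT2 in IH2; destruct IH2 as (z & E & H); rewrite E.
    apply (next_ex R (h k)); now exists z. }
  exists h; split; [reflexivity|]; intros k; apply Hh.
Qed.

Lemma path_fun R T p h h' : successor_selection (next R) T ->
  h 0 = h' 0 -> path T p h -> path T p h' -> h = h'.
Proof.
  intros (HT1 & _) H0 H H'; apply functional_extensionality.
  induction x as [|k IH]; [exact H0|]; specialize (H k); specialize (H' k).
  rewrite IH in H; eauto.
Qed.

Lemma path_state R T p h k : successor_selection (next R) T -> path T p h ->
  exists z, h (S k) = S z /\ extendable R z /\ forall y, h k = S y -> R y z.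
Proof.
  intros (_ & HT2 & _) H; destruct (HT2 _ _ _ (H k)) as (z & E & Hz & Hr).
  exists z; split; [exact E|split; [exact Hz|]]; intros y Hy.
  destruct Hr as [Hr|(n & Hn & Hr)]; [congruence|].
  rewrite Hy in Hn; injection Hn as ->; exact Hr.
Qed.

Lemma path_mono R T p h x k z l : transitive nat R ->
  successor_selection (next R) T -> path T p h ->
  h k = S z -> R x z -> k <= l -> exists z', h l = S z' /\ R x z'.
Proof.
  intros HR HT H Hk Hx Hl; induction Hl as [|l Hl IH]; [eauto|].
  destruct IH as (y & Hy & Hxy).
  destruct (path_state R T p h l HT H) as (z' & E & _ & Hz').
  exists z'; split; [exact E|]; exact (HR _ _ _ Hxy (Hz' _ Hy)).
Qed.

Lemma limit_ideal R T p h : transitive nat R ->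
  successor_selection (next R) T -> path T p h -> rounded_ideal R (limit R h).
Proof.
  intros HR HT H.
  assert (Hin : forall k z, h k = S z -> limit R h z).
  { intros k z Hz; destruct (path_state R T p h k HT H) as (y & Hy & _ & Hr).
    exists (S k), y; auto. }
  split; [|split].
  - destruct (path_state R T p h 0 HT H) as (y & Hy & _); eauto.
  - intros x y (k & z & Hz & Hy) Hxy; exists k, z; split; [exact Hz|].
    exact (HR _ _ _ Hxy Hy).
  - intros x y (k & z & Hz & Hx) (l & z' & Hz' & Hy).
    (* Both bounds are carried to stage [k + l], where they are the same link. *)
    destruct (path_mono R T p h x k z (k + l) HR HT H Hz Hx) as (u & Hu & Hxu); [lia|].
    destruct (path_mono R T p h y l z' (k + l) HR HT H Hz' Hy) as (u' & Hu' & Hyu);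
      [lia|].
    rewrite Hu in Hu'; injection Hu' as <-; exists u; eauto.
Qed.

(** Nonzero states and enumerations of ideals both represent [z] by [S z], so
    [o l = s'] means that the state [s'] lies in the ideal enumerated by [o]. *)
Definition advance (R T : nat -> nat -> Prop) (o : baire) (k s i s' : nat) : Prop :=
  T (npair s i) s' /\ (exists l, o l = s') /\
  (o k = 0 \/ exists x z, o k = S x /\ s' = S z /\ R x z).

Lemma advance_ex R T (o : baire) I k s : successor_selection (next R) T ->
  rounded_ideal R I -> (forall n, I n <-> exists l, o l = S n) ->
  (s = 0 \/ exists l, o l = s) -> exists i s', advance R T o k s i s'.
Proof.
  intros (_ & _ & HT3 & _) HI Ho Hs; pose proof HI as ([x0 Hx0] & H2 & H3).
  (* The new link must lie above the current one and above the element listed at [k]; where one of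
     these is missing, the member [x0] takes its place. *)
  assert (Hdir : forall s k, (s = 0 \/ exists l, o l = s) ->
    exists z, I z /\ forall x, (s = S x \/ o k = S x) -> R x z).
  { clear k s Hs; intros s k Hs.
    assert (W : forall s, (s = 0 \/ exists l, o l = s) ->
      exists y, I y /\ forall x, s = S x -> x = y).
    { intros [|y] Hy; [exists x0; split; [exact Hx0|discriminate]|].
      exists y; split; [|congruence].
      apply Ho; destruct Hy as [?|?]; [discriminate|assumption]. }
    destruct (W s Hs) as (y & Hy & Ey), (W (o k)) as (y' & Hy' & Ey'); [eauto|].
    destruct (H3 y y' Hy Hy') as (z & Hz & Hr & Hr').
    exists z; split; [exact Hz|]; intros x [E|E].
    - now rewrite (Ey x E).
    - now rewrite (Ey' x E). }
  destruct (Hdir s k Hs) as (z & Hz & Hr).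
  destruct (HT3 s (S z)) as [i Hi].
  { exists z; split; [reflexivity|split; [now exists I|]].
    destruct s as [|n]; [auto|right; exists n; auto]. }
  exists i, (S z); split; [exact Hi|split; [now apply Ho|]].
  destruct (o k) as [|x] eqn:E; [auto|right; exists x, z; auto].
Qed.

(** Step [k] places a link above the element listed at [k], so the chain is cofinal in [I], and all
    its links lie in [I]. *)
Lemma advance_limit R T (o : baire) I p h : rounded_ideal R I ->
  (forall n, I n <-> exists l, o l = S n) ->
  (h 0 = 0 \/ exists l, o l = h 0) ->
  (forall k, advance R T o k (h k) (p k) (h (S k))) -> I = limit R h.
Proof.
  intros (H1 & H2 & H3) Ho H0 Ha; apply set_ext; intros x; split.
  - intros Hx; apply Ho in Hx; destruct Hx as [k Hk].
    destruct (Ha k) as (_ & _ & [E|(y & z & E & Ez & Hr)]); [congruence|].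
    rewrite Hk in E; injection E as <-; exists (S k), z; auto.
  - intros (k & z & Hz & Hr); apply (H2 x z); [|exact Hr]; apply Ho.
    destruct k as [|k].
    + rewrite Hz in H0; destruct H0 as [?|?]; [discriminate|assumption].
    + destruct (Ha k) as (_ & [l Hl] & _); rewrite Hz in Hl; eauto.
Qed.

(** The selector [v] of moves is abstract so that one recursion serves both a classical choice of
    moves and the moves found by a program. *)
Lemma advance_rec R T (o : baire) I (v : nat -> nat) s : successor_selection (next R) T ->
  rounded_ideal R I -> (forall n, I n <-> exists l, o l = S n) ->
  (s = 0 \/ exists l, o l = s) ->
  (forall k s, (s = 0 \/ exists l, o l = s) ->
     advance R T o k s (pfst (v (npair k s))) (psnd (v (npair k s)))) ->
  let h := nat_rec (fun _ => nat) s (fun k a => psnd (v (npair k a))) in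
  forall k, (h k = 0 \/ exists l, o l = h k) /\
    advance R T o k (h k) (pfst (v (npair k (h k)))) (h (S k)).
Proof.
  intros HT HI Ho Hs Hv h.
  assert (E : forall k, h (S k) = psnd (v (npair k (h k)))) by reflexivity.
  assert (G : forall k, h k = 0 \/ exists l, o l = h k).
  { induction k as [|k IH]; [exact Hs|]; right; rewrite E.
    exact (proj1 (proj2 (Hv k _ IH))). }
  intros k; split; [apply G|]; rewrite E; apply Hv, G.
Qed.

(** The start is an arbitrary state because the path has to continue a finite word of choices
    already made. *)
Lemma ideal_path R T (o : baire) I s : successor_selection (next R) T ->
  rounded_ideal R I -> (forall n, I n <-> exists l, o l = S n) ->
  (s = 0 \/ exists l, o l = s) ->
  exists p h, h 0 = s /\ path T p h /\ I = limit R h.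
Proof.
  intros HT HI Ho Hs.
  assert (Hv : forall c, exists m, (exists i s', advance R T o (pfst c) (psnd c) i s') ->
    advance R T o (pfst c) (psnd c) (pfst m) (psnd m)).
  { intros c; destruct (classic (exists i s', advance R T o (pfst c) (psnd c) i s'))
      as [(i & s' & H)|N]; [|exists 0; tauto].
    exists (npair i s'); now rewrite pfst_npair, psnd_npair. }
  destruct (choice _ Hv) as [v Hv'].
  assert (Hw : forall k s, (s = 0 \/ exists l, o l = s) ->
     advance R T o k s (pfst (v (npair k s))) (psnd (v (npair k s)))).
  { intros k s' Hs'; specialize (Hv' (npair k s')).
    rewrite pfst_npair, psnd_npair in Hv'; apply Hv'.
    now apply (advance_ex R T o I). }
  pose proof (advance_rec R T o I v s HT HI Ho Hs Hw) as H.
  set (h := nat_rec _ _ _) in H.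
  exists (fun k => pfst (v (npair k (h k)))), h; split; [reflexivity|split].
  - intros k; apply H.
  - apply (advance_limit R T o I (fun k => pfst (v (npair k (h k))))); auto.
    intros k; apply H.
Qed.

Lemma run_ideal_path R T : ce_rel R -> successor_selection (next R) T ->
  semi (fun _ c => T (pfst c) (psnd c)) ->
  exists e, forall (o : baire) I, rounded_ideal R I ->
    (forall n, I n <-> exists l, o l = S n) ->
    exists p h, run e o p /\ h 0 = 0 /\ path T p h /\ I = limit R h.
Proof.
  rewrite ce_rel_iff; intros HR HT HTs.
  destruct (semi_select (fun o c => advance R T o (pfst (pfst c)) (psnd (pfst c))
    (pfst (psnd c)) (psnd (psnd c)))) as [e He].
  { unfold advance; solve_semi. }
  (* [st] iterates the move found by [e]: the inner [Snd] extracts the pair of stage and state from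
     the step argument, and the outer one keeps the new state. *)
  set (st := Rec Zero (Comp Snd (Comp e Snd))).
  set (idp := Pair Fst Snd).
  (* The input [k] is doubled to serve as parameter and as number of rounds of [st]. *)
  exists (Comp Fst (Comp e (Pair idp (Comp st (Pair idp idp))))).
  intros o I HI Ho.
  assert (Hv : forall c, exists m, (exists m, eval e o c m) -> eval e o c m).
  { intros c; destruct (classic (exists m, eval e o c m)) as [[m Hm]|N];
      [now exists m|exists 0; tauto]. }
  destruct (choice _ Hv) as [v Hv'].
  assert (Hw' : forall k s, (s = 0 \/ exists l, o l = s) ->
     eval e o (npair k s) (v (npair k s))).
  { intros k s Hs; apply Hv'; apply (proj2 (He o (npair k s))).
    destruct (advance_ex R T o I k s HT HI Ho Hs) as (i & s' & H).
    exists (npair i s'); cbv beta; now rewrite !psnd_npair, !pfst_npair, !psnd_npair. }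
  assert (Hw : forall k s, (s = 0 \/ exists l, o l = s) ->
     advance R T o k s (pfst (v (npair k s))) (psnd (v (npair k s)))).
  { intros k s Hs; pose proof (proj1 (He o (npair k s)) _ (Hw' k s Hs)) as H.
    cbv beta in H; now rewrite !psnd_npair, !pfst_npair, !psnd_npair in H. }
  pose proof (advance_rec R T o I v 0 HT HI Ho (or_introl eq_refl) Hw) as H.
  set (h := nat_rec _ _ _) in H.
  exists (fun k => pfst (v (npair k (h k)))), h.
  split; [|split; [reflexivity|split]].
  - intros k; exists (v (npair k (h k))); split; [|reflexivity].
    exists (npair k (h k)); split; [|apply Hw', H].
    exists k, (h k); split; [|split; [|reflexivity]].
    + exists (pfst k), (psnd k); now rewrite npair_eta.
    + exists (npair k k); split.
      { exists k, k; split; [|split; [|reflexivity]];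
          exists (pfst k), (psnd k); now rewrite npair_eta. }
      exists h; rewrite pfst_npair, psnd_npair.
      split; [reflexivity|split; [|reflexivity]].
      intros j Hj; exists (v (npair j (h j))); split; [|reflexivity].
      exists (npair j (h j)); split; [symmetry; apply psnd_npair|apply Hw', H].
  - intros k; apply H.
  - apply (advance_limit R T o I (fun k => pfst (v (npair k (h k))))); auto.
    intros k; apply H.
Qed.

Definition reach (T : nat -> nat -> Prop) (w s : nat) : Prop :=
  exists u, pnth u 0 = 0 /\
    (forall j, j < plen w -> T (npair (pnth u j) (pnth w j)) (pnth u (S j))) /\
    s = pnth u (plen w).

Lemma semi_reach T : semi (fun _ c => T (pfst c) (psnd c)) ->
  semi (fun _ c => reach T (pfst c) (psnd c)).
Proof. intros HT; unfold reach; solve_semi. Qed.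

Lemma reach_prefix R T p h k s : successor_selection (next R) T ->
  h 0 = 0 -> path T p h -> (reach T (prefix p k) s <-> s = h k).
Proof.
  intros (HT1 & _) H0 Hp; unfold reach; rewrite plen_prefix; split.
  - intros (u & Hu0 & Hu & ->).
    assert (E : forall j, j <= k -> pnth u j = h j).
    { induction j as [|j IH]; intros Hj; [congruence|].
      specialize (Hu j Hj); rewrite IH, pnth_prefix in Hu by lia.
      exact (HT1 _ _ _ Hu (Hp j)). }
    now apply E.
  - intros ->; exists (prefix h (S k)); rewrite !pnth_prefix by lia.
    split; [exact H0|split; [|reflexivity]].
    intros j Hj; rewrite !pnth_prefix by lia; apply Hp.
Qed.

Definition path_names (X : repspace) R T (f : X -> RI R) (p : baire) (x : X) : Prop :=
  exists h, h 0 = 0 /\ path T p h /\ proj1_sig (f x) = limit R h.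

(** Reconstructs the states from the choices, which makes membership in the limit semidecidable from
    [p] alone. *)
Definition in_limit (R T : nat -> nat -> Prop) (p : baire) (n : nat) : Prop :=
  exists k z, reach T (prefix p k) (S z) /\ R n z.

Lemma semi_in_limit R T : ce_rel R -> semi (fun _ c => T (pfst c) (psnd c)) ->
  semi (in_limit R T).
Proof.
  rewrite ce_rel_iff; intros HR HT; pose proof (semi_reach T HT).
  unfold in_limit; solve_semi.
Qed.

Lemma in_limit_iff R T p h n : successor_selection (next R) T ->
  h 0 = 0 -> path T p h -> (in_limit R T p n <-> limit R h n).
Proof.
  intros HT H0 Hp; unfold in_limit, limit.
  setoid_rewrite (reach_prefix R T p h _ _ HT H0 Hp).
  split; intros (k & z & E & H); exists k, z; auto.
Qed.

(** A path generating [I] is appended to [w]. Links increase along a path, so those visited during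
    [w] lie below later ones and the limit is that of the appended path. *)
Lemma reach_extend R T w s I : transitive nat R -> successor_selection (next R) T ->
  rounded_ideal R I -> reach T w s -> (s = 0 \/ exists z, s = S z /\ I z) ->
  exists p h, prefix p (plen w) = w /\ h 0 = 0 /\ path T p h /\ I = limit R h.
Proof.
  intros HR HT HI (u & Hu0 & Hu & ->) Hs.
  set (o := fun n => if decide (I n) then S n else 0).
  assert (Ho : forall n, I n <-> exists l, o l = S n).
  { intros n; unfold o; split.
    - intros Hn; exists n; destruct (decide _); tauto.
    - intros [l Hl]; destruct (decide _); [congruence|discriminate]. }
  destruct (ideal_path R T o I (pnth u (plen w)) HT HI Ho) as (p & h & H0 & Hp & HIh).
  { destruct Hs as [Hs|(z & Hz & Hi)]; [auto|right; rewrite Hz; now apply Ho]. }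
  set (p' := fun i => if lt_dec i (plen w) then pnth w i else p (i - plen w)).
  set (h' := fun i => if lt_dec i (plen w) then pnth u i else h (i - plen w)).
  assert (Hh' : forall i, i <= plen w -> h' i = pnth u i).
  { intros i Hi; unfold h'; destruct (lt_dec _ _); [reflexivity|].
    replace i with (plen w) by lia; now rewrite Nat.sub_diag. }
  assert (Hp' : path T p' h').
  { intros k; destruct (lt_dec k (plen w)) as [L|L].
    - rewrite !Hh' by lia; unfold p'; destruct (lt_dec _ _); [auto|lia].
    - unfold p', h'; destruct (lt_dec k (plen w)), (lt_dec (S k) (plen w)); try lia.
      replace (S k - plen w) with (S (k - plen w)) by lia; apply Hp. }
  exists p', h'; split; [|split; [|split; [exact Hp'|]]].
  - apply prefix_is; intros i Hi; unfold p'; destruct (lt_dec _ _); [reflexivity|lia].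
  - rewrite Hh' by lia; exact Hu0.
  - rewrite HIh; apply set_ext; intros x; split.
    + intros (k & z & Hz & Hx); exists (plen w + k), z; split; [|exact Hx].
      unfold h'; destruct (lt_dec _ _); [lia|].
      now replace (plen w + k - plen w) with k by lia.
    + intros (k & z & Hz & Hx).
      destruct (path_mono R T p' h' x k z (plen w + k) HR HT Hp' Hz Hx)
        as (z' & Hz' & Hx'); [lia|].
      exists k, z'; split; [|exact Hx']; rewrite <- Hz'; unfold h'.
      destruct (lt_dec _ _); [lia|]; f_equal; lia.
Qed.

(** An open set meets the fiber iff some word verified in it reaches the initial state or a link in
    the ideal, which is semidecidable from a name of the point. *)
Lemma path_fiber_overt (X : repspace) (d : representation X) R T (f : X -> RI R) :
  transitive nat R -> ce_rel R -> successor_selection (next R) T ->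
  semi (fun _ c => T (pfst c) (psnd c)) ->
  (forall p x, names d p x <-> path_names X R T f p x) ->
  effectively_fiber_overt d.
Proof.
  intros HR HRce HT HTs Hd.
  pose proof (semi_reach T HTs) as HTr; pose proof (semi_rgt _ semi_verif) as Hv.
  pose proof (semi_lft _ (semi_in_limit R T HRce HTs)) as Hl.
  destruct (names_open_intro (fun o u _ => exists w, verif u w /\ exists s,
    reach T w s /\ (s = 0 \/ exists z, s = S z /\ in_limit R T o z)) (OpenSets NN))
    as (F & HF & Hn).
  { unfold semi2; set (V := fun o w => verif (rgt o) w) in *.
    set (L := fun o z => in_limit R T (lft o) z) in *.
    change (semi (fun o _ => exists w, V o w /\ exists s, reach T w s /\
      (s = 0 \/ exists z, s = S z /\ L o z))).
    clearbody V L; solve_semi. }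
  apply computable_map_iff.
  destruct (run_comp (fun o i => F o 0 i)) as [e He]; [unfold cfun in HF; solve_comp|].
  exists e; intros p x Hp; exists (F p 0); split; [apply He|].
  apply (Hn p 0 (meets NN (closure NN (fun q => names d q x)))).
  intros u U Hu; apply Hd in Hp; destruct Hp as (h & H0 & Hh & HI).
  assert (HL : forall z, in_limit R T p z <-> proj1_sig (f x) z).
  { intros z; rewrite HI; now apply in_limit_iff. }
  setoid_rewrite HL; unfold in_open; simpl; split.
  - intros (w & Hw & s & Hws & Hs).
    destruct (reach_extend R T w s _ HR HT (proj2_sig (f x)) Hws Hs)
      as (q & h' & Hq & H0' & Hh' & HI').
    exists q; split.
    + apply (memb_iff NN u U q q Hu eq_refl); exists (plen w); now rewrite Hq.
    + intros U' _ Hq'; exists q; split; [exact Hq'|]; apply Hd; now exists h'.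
  (* An open set that meets the closure of the fiber meets the fiber itself. *)
  - intros (q & HUq & Hcl); destruct (Hcl _ (proj2_sig U) HUq) as (q' & HUq' & Hq').
    apply (memb_iff NN u U q' q' Hu eq_refl) in HUq'; destruct HUq' as [k Hk].
    apply Hd in Hq'; destruct Hq' as (h' & H0' & Hh' & HI').
    exists (prefix q' k); split; [exact Hk|]; exists (h' k).
    split; [now apply (reach_prefix R T q' h')|].
    destruct (h' k) as [|z] eqn:E; [auto|right; exists z; split; [reflexivity|]].
    destruct (path_state R T q' h' k HT Hh') as (y & Hy & _ & Hr).
    assert (G : limit R h' z) by (exists (S k), y; auto).
    rewrite <- HI' in G; exact G.
Qed.

Lemma extendable_total_rep (X : repspace) R : inhabited X ->
  transitive nat R -> ce_rel R -> computably_isomorphic X (RI R) ->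
  ce (extendable R) -> exists d : representation X,
    admits X d /\ effectively_fiber_overt d /\ computably_admissible d /\ total d.
Proof.
  intros [x0] HR HRce (f & g & Hgf & Hfg & Hf & Hg) HE.
  destruct (successor_selection_ex _ (semi_next R HRce HE)) as (T & HT & HTs).
  assert (Hinj : forall p x y, path_names X R T f p x -> path_names X R T f p y -> x = y).
  { intros p x y (h & H0 & Hp & HI) (h' & H0' & Hp' & HI').
    rewrite <- (Hgf x), <- (Hgf y); f_equal; apply sig_eq; rewrite HI, HI'.
    now rewrite (path_fun R T p h h' HT (eq_trans H0 (eq_sym H0')) Hp Hp'). }
  destruct (run_ideal_path R T HRce HT HTs) as [e He].
  assert (Hconv : forall o I, names (rep (RI R)) o I -> exists p,
    run e o p /\ path_names X R T f p (g I)).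
  { intros o I Ho; destruct (He o _ (proj2_sig I) Ho) as (p & h & Hr & H0 & Hp & HI).
    exists p; split; [exact Hr|]; exists h; rewrite Hfg; auto. }
  assert (Hsurj : forall x, exists p, path_names X R T f p x).
  { intros x; destruct (names_surj (rep (RI R)) (f x)) as [o Ho].
    destruct (Hconv o _ Ho) as (p & _ & Hp); rewrite Hgf in Hp; eauto. }
  set (d := Representation (path_names X R T f) Hinj Hsurj).
  assert (HgD : computable_map (RI R) (RepSpace d) g).
  { apply computable_map_iff; exists e; exact Hconv. }
  assert (HfD : computable_map (RepSpace d) (RI R) f).
  { apply computable_map_iff.
    destruct (run_enumeration _ (semi_in_limit R T HRce HTs)) as [r Hr].
    exists r; intros p x (h & H0 & Hp & HI); destruct (Hr p) as (q & Hq & Hqn).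
    exists q; split; [exact Hq|]; intros n; rewrite <- Hqn, HI.
    symmetry; now apply in_limit_iff. }
  exists d; split; [|split; [|split]].
  - split.
    + apply (computable_map_ext X (RepSpace d) (fun x => g (f x))); [exact Hgf|].
      exact (computable_map_comp X (RI R) (RepSpace d) f g Hf HgD).
    + apply (computable_map_ext (RepSpace d) X (fun x => g (f x))); [exact Hgf|].
      exact (computable_map_comp (RepSpace d) (RI R) X f g HfD Hg).
  - apply (path_fiber_overt X d R T f); auto; reflexivity.
  - exact (RI_admissible X d R f g Hgf HfD HgD).
  - intros p; destruct (path_ex R T 0 p HT) as (h & H0 & Hp).
    (* The ideal of [x0] supplies a first link, so no sequence of choices is blocked at the
       start. *)
    { destruct (proj2_sig (f x0)) as ([y Hy] & H2 & H3).
      exists (S y), y; split; [reflexivity|split; [|auto]].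
      exists (proj1_sig (f x0)); split; [exact (proj2_sig (f x0))|exact Hy]. }
    exists (g (exist _ _ (limit_ideal R T p h HR HT Hp))), h.
    rewrite Hfg; auto.
Qed.

(** * Countable bases from open representations *)

Definition cyl {X : Type} (d : representation X) (w : nat) (x : X) : Prop :=
  exists q, names d q x /\ prefix q (plen w) = w.

(** The name of the closed fiber is applied to the open cylinder of [w]; an open set meets a closure
    iff it meets the set. *)
Lemma semi_cyl {X : Type} (d : representation X) : effectively_fiber_overt d ->
  exists M, semi M /\ forall p x w, names d p x -> (M p w <-> cyl d w x).
Proof.
  intros Hd; apply computable_map_iff in Hd; destruct Hd as [e He].
  assert (HW : semi (fun q w => w = prefix q (plen w))) by solve_semi.
  destruct (names_open_intro (fun _ q w => w = prefix q (plen w)) NN)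
    as (F & HF & Hn); [exact (semi_rgt _ HW)|].
  assert (Ho : forall w, is_open NN (fun q => w = prefix q (plen w))).
  { intros w; apply (semi_open _ NN _ w HW); now intros p x <-. }
  destruct (graph_run e (fun o _ => o)) as (G1 & HG1 & H1);
    [unfold cfun; solve_comp|].
  destruct (graph_cfun F HF) as (G2 & HG2 & H2).
  destruct (semi2_sub G1 G2 _ HG1 HG2 semi2_memb) as (M & HM & H).
  exists M; split; [exact HM|]; intros p x w Hp.
  destruct (He p x Hp) as (a & Ha & Hna).
  rewrite (H p w a (F p w) (H1 p w a Ha) (H2 p w)).
  set (A := meets NN (closure NN (fun p => names d p x))).
  set (U := exist _ _ (Ho w) : OpenSets NN).
  assert (HU : names (rep (OpenSets NN)) (F p w) U).
  { apply Hn; now intros q y <-. }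
  assert (Ha' : names (rep (OpenSets (OpenSets NN))) a A) by exact Hna.
  rewrite (memb_iff _ _ _ _ _ Ha' HU); unfold in_open, A; simpl; split.
  - intros (q & Hq & Hcl); destruct (Hcl _ (Ho w) Hq) as (q' & Hq' & Hx).
    exists q'; auto.
  - intros (q & Hq & Hw); exists q; split; [symmetry; exact Hw|].
    intros V _ HV; now exists q.
Qed.

(** [Fo s w] approximates inclusion of the image of the cylinder of [s] in that of [w]: the first
    clause is soundness, the second eventual and persistent completeness along each name. *)
Definition forcing {X : Type} (d : representation X) (Fo : nat -> nat -> Prop) : Prop :=
  (forall p x k w, names d p x -> Fo (prefix p k) w -> cyl d w x) /\
  (forall p x w, names d p x -> cyl d w x ->
     exists k, forall l, k <= l -> Fo (prefix p l) w).

Lemma forcing_ex {X : Type} (d : representation X) : effectively_fiber_overt d ->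
  exists Fo, dec (fun _ c => Fo (pfst c) (psnd c)) /\ forcing d Fo.
Proof.
  intros Hd; destruct (semi_cyl d Hd) as (M & [D [HD HM]] & H).
  exists (fun s w => exists i, i < S (plen s) /\ D (npair w (ptake s i))).
  split; [solve_dec|split].
  - intros p x k w Hp (i & Hi & Hd'); apply (H p x w Hp), HM; exists i.
    rewrite plen_prefix in Hi; now rewrite ptake_prefix in Hd' by lia.
  - intros p x w Hp Hc; apply (H p x w Hp), HM in Hc; destruct Hc as [k Hk].
    exists k; intros l Hl; exists k; rewrite plen_prefix.
    split; [lia|]; now rewrite ptake_prefix by lia.
Qed.

Lemma cyl_open {X : Type} (d : representation X) U x : is_open (RepSpace d) U -> U x ->
  exists w, cyl d w x /\ forall y, cyl d w y -> U y.
Proof.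
  intros HU Hx; destruct (names_surj d x) as [p Hp].
  destruct (HU p x Hp Hx) as [k Hk]; exists (prefix p k); split.
  - exists p; rewrite plen_prefix; auto.
  - intros y (q & Hq & E); rewrite plen_prefix in E; apply (Hk q y Hq).
    intros i Hi; rewrite <- (pnth_prefix p k i Hi), <- E, pnth_prefix; auto.
Qed.

(** By [cyl_open] the images of cylinders containing a point determine its open neighbourhoods, and
    these determine the point by admissibility. *)
Lemma cyl_inj {X : Type} (d : representation X) x y : computably_admissible d ->
  (forall w, cyl d w x <-> cyl d w y) -> x = y.
Proof.
  intros [Hinj _] H; apply Hinj, sig_eq, set_ext; intros U; split; intros HU.
  - destruct (cyl_open d _ x (proj2_sig U) HU) as (w & Hw & Hy); apply Hy, H, Hw.
  - destruct (cyl_open d _ y (proj2_sig U) HU) as (w & Hw & Hy); apply Hy, H, Hw.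
Qed.

Definition strict_ext (w v : nat) : Prop := plen w < plen v /\ ptake v (plen w) = w.

Lemma strict_ext_agree w v : strict_ext w v -> agree (plen w) (pnth v) (pnth w).
Proof. intros [L E]; rewrite ptake_le in E by lia; now apply prefix_plen_agree in E. Qed.

Lemma strict_ext_prefix q w k : prefix q (plen w) = w -> plen w < k ->
  strict_ext w (prefix q k).
Proof.
  intros E L; split; [now rewrite plen_prefix|]; now rewrite ptake_prefix by lia.
Qed.

(** The sets of words [I] that should be of the form [{w | cyl d w x}]. *)
Definition saturated (Fo : nat -> nat -> Prop) (I : nat -> Prop) : Prop :=
  I 0 /\ (forall w v, I w -> Fo w v -> I v) /\
  (forall w v, I w -> I v -> exists u, I u /\ strict_ext w u /\ Fo u v).

Lemma cyl_saturated {X : Type} (d : representation X) Fo x :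
  forcing d Fo -> saturated Fo (fun w => cyl d w x).
Proof.
  intros [Hs Hc]; split; [|split].
  - destruct (names_surj d x) as [p Hp]; exists p; auto.
  - intros w v (q & Hq & E) Hf; rewrite <- E in Hf; eauto.
  - intros w v (q & Hq & E) Hv; destruct (Hc q x v Hq Hv) as [k Hk].
    exists (prefix q (S (k + plen w))); split; [|split].
    + exists q; rewrite plen_prefix; auto.
    + apply strict_ext_prefix; [exact E|lia].
    + apply Hk; lia.
Qed.

(** Stage [i] properly extends the current word inside [I] and, if [i] lies in [I], forces [i]. As
    words are numbers, every member of [I] gets its stage. *)
Lemma saturated_path Fo I : saturated Fo I -> exists p,
  (forall k, exists l, k <= l /\ I (prefix p l)) /\
  (forall v, I v -> exists k, Fo (prefix p k) v).
Proof.
  intros (H0 & H1 & H2).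
  assert (Hv : forall c, exists u, I (psnd c) -> I u /\ strict_ext (psnd c) u /\
    (I (pfst c) -> Fo u (pfst c))).
  { intros c; destruct (classic (I (psnd c))) as [Hw|N]; [|exists 0; tauto].
    destruct (classic (I (pfst c))) as [Hv|N].
    - destruct (H2 _ _ Hw Hv) as (u & ? & ? & ?); exists u; auto.
    (* With nothing to force at this stage, forcing the empty word still provides a proper
       extension. *)
    - destruct (H2 _ _ Hw H0) as (u & ? & ? & ?); exists u; tauto. }
  destruct (choice _ Hv) as [v Hv'].
  set (s := nat_rec (fun _ => nat) 0 (fun i a => v (npair i a))).
  assert (Hstep : forall i, I (s i) -> I (s (S i)) /\ strict_ext (s i) (s (S i)) /\
    (I i -> Fo (s (S i)) i)).
  { intros i Hi; specialize (Hv' (npair i (s i))).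
    rewrite pfst_npair, psnd_npair in Hv'; exact (Hv' Hi). }
  assert (HI : forall i, I (s i)).
  { induction i as [|i IH]; [exact H0|apply (Hstep i IH)]. }
  assert (Hlen : forall i, i <= plen (s i)).
  { induction i as [|i IH]; [lia|].
    destruct (Hstep i (HI i)) as (_ & [L _] & _); lia. }
  assert (Hag : forall i j, i <= j -> plen (s i) <= plen (s j) /\
    agree (plen (s i)) (pnth (s j)) (pnth (s i))).
  { intros i j Hij; induction Hij as [|j Hij [IH1 IH2]].
    - split; [lia|intros n _; reflexivity].
    - destruct (Hstep j (HI j)) as (_ & Hx & _).
      pose proof (strict_ext_agree _ _ Hx) as Hy; destruct Hx as [L _].
      split; [lia|]; intros n Hn; rewrite (Hy n) by lia; auto. }
  (* The word of stage [S n] has more than [n] entries, so position [n] is already settled there. *)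
  set (p := fun n => pnth (s (S n)) n).
  assert (Hp : forall i, prefix p (plen (s i)) = s i).
  { intros i; apply prefix_is; intros n Hn; unfold p.
    destruct (le_lt_dec i (S n)) as [L|L].
    - now apply (Hag i (S n)).
    - symmetry; apply (Hag (S n) i); [lia|]; pose proof (Hlen (S n)); lia. }
  exists p; split.
  - intros k; exists (plen (s k)); rewrite Hp; auto.
  - intros w Hw; exists (plen (s (S w))); rewrite Hp; now apply Hstep.
Qed.

(** Totality makes the path through [I] a name of some [x]. If [x] lies in the image of the cylinder
    of [w], all long prefixes force [w], and some of these lie in [I]. *)
Lemma saturated_cyl {X : Type} (d : representation X) Fo I :
  forcing d Fo -> total d -> saturated Fo I -> exists x, forall w, I w <-> cyl d w x.
Proof.
  intros [Hs Hc] Ht HI; destruct (saturated_path Fo I HI) as (p & Hp1 & Hp2).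
  destruct (Ht p) as [x Hx]; exists x; intros w; split.
  - intros Hw; destruct (Hp2 w Hw) as [k Hk]; eauto.
  - intros Hw; destruct (Hc p x w Hx Hw) as [k Hk].
    destruct (Hp1 k) as (l & Hl & Hi); destruct HI as (_ & HI & _); eauto.
Qed.

(** * The ideal completion of the finite subsets of saturated sets *)

(** A condition [c] consists of a stage [pfst c] and a finite set of words. *)
Definition elem (c w : nat) : Prop :=
  exists i, i < plen (psnd c) /\ pnth (psnd c) i = w.

(** The stage bounds the forced words that are demanded, which keeps the relation decidable for
    decidable [Fo]; its strict growth ensures that each forced word is demanded eventually. *)
Definition refines (Fo : nat -> nat -> Prop) (c d : nat) : Prop :=
  pfst c < pfst d /\ elem d 0 /\ (forall w, elem c w -> elem d w) /\
  (forall w v, elem c w -> v < pfst c -> Fo w v -> elem d v) /\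
  (forall w v, elem c w -> elem c v -> exists u, elem d u /\ strict_ext w u /\ Fo u v).

Lemma dec_elem : dec (fun _ c => elem (pfst c) (psnd c)).
Proof. unfold elem; solve_dec. Qed.

Lemma ce_refines Fo : dec (fun _ c => Fo (pfst c) (psnd c)) -> ce_rel (refines Fo).
Proof.
  intros HF; apply ce_rel_iff, semi_dec; pose proof dec_elem as He.
  (* Quantifiers over elements become bounded quantifiers over positions in the coded lists. *)
  apply (dec_ext (fun _ cd => (fun c d => pfst c < pfst d /\ elem d 0 /\
    (forall i, i < plen (psnd c) -> elem d (pnth (psnd c) i)) /\
    (forall i, i < plen (psnd c) -> forall v, v < pfst c ->
       Fo (pnth (psnd c) i) v -> elem d v) /\
    (forall i, i < plen (psnd c) -> forall j, j < plen (psnd c) ->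
       exists k, k < plen (psnd d) /\
         strict_ext (pnth (psnd c) i) (pnth (psnd d) k) /\
         Fo (pnth (psnd d) k) (pnth (psnd c) j))) (pfst cd) (psnd cd))).
  - intros _ cd; generalize (pfst cd) (psnd cd); intros c d; unfold refines.
    split; intros (H1 & H2 & H3 & H4 & H5).
    + split; [exact H1|split; [exact H2|split; [|split]]].
      * intros w (i & Hi & <-); auto.
      * intros w v (i & Hi & <-); eauto.
      * intros w v (i & Hi & <-) (j & Hj & <-).
        destruct (H5 i Hi j Hj) as (k & Hk & H); exists (pnth (psnd d) k).
        split; [now exists k|exact H].
    + split; [exact H1|split; [exact H2|split; [|split]]].
      * intros i Hi; apply H3; now exists i.
      * intros i Hi v Hv Hf; apply (H4 (pnth (psnd c) i) v); auto; now exists i.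
      * intros i Hi j Hj.
        destruct (H5 (pnth (psnd c) i) (pnth (psnd c) j)) as (u & (k & Hk & <-) & H);
          [now exists i|now exists j|].
        exists k; auto.
  - unfold strict_ext; solve_dec.
Qed.

(** What [d] provides for [c] persists in [e], because [e] contains [d]. *)
Lemma refines_trans Fo : transitive nat (refines Fo).
Proof.
  intros c d e (H1 & H2 & H3 & H4 & H5) (H1' & H2' & H3' & H4' & H5').
  split; [lia|split; [exact H2'|split; [auto|split]]].
  - eauto.
  - intros w v Hw Hv; destruct (H5 w v Hw Hv) as (u & Hu & H); exists u; auto.
Qed.

Lemma condition_ex n (l : list nat) :
  exists c, pfst c = n /\ forall w, elem c w <-> In w l.
Proof.
  exists (npair n (prefix (fun i => nth i l 0) (length l))).
  unfold elem; rewrite pfst_npair, psnd_npair, plen_prefix.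
  split; [reflexivity|]; intros w; split.
  - intros (i & Hi & <-); rewrite pnth_prefix by exact Hi; now apply nth_In.
  - intros Hw; destruct (In_nth l w 0 Hw) as (i & Hi & E); exists i.
    now rewrite pnth_prefix.
Qed.

Lemma elem_list c : exists l, forall w, elem c w <-> In w l.
Proof.
  exists (map (pnth (psnd c)) (seq 0 (plen (psnd c)))); intros w.
  rewrite in_map_iff; setoid_rewrite in_seq; unfold elem.
  split; intros (i & H); exists i; intuition lia.
Qed.

Definition conditions (I : nat -> Prop) : nat -> Prop :=
  fun c => forall w, elem c w -> I w.

Lemma conditions_inj I I' : conditions I = conditions I' -> I = I'.
Proof.
  assert (W : forall I I', conditions I = conditions I' -> forall w, I w -> I' w).
  { intros A B E w Hw; destruct (condition_ex 0 (w :: nil)) as (c & _ & Hc).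
    assert (H : conditions A c).
    { intros v Hv; apply Hc in Hv; destruct Hv as [<-|[]]; exact Hw. }
    rewrite E in H; apply H, Hc; now left. }
  intros E; apply set_ext; intros w; split; apply W; congruence.
Qed.

Lemma conditions_ideal Fo I : saturated Fo I -> rounded_ideal (refines Fo) (conditions I).
Proof.
  intros (H0 & H1 & H2); split; [|split].
  - destruct (condition_ex 0 nil) as (c & _ & Hc); exists c; intros w Hw.
    apply Hc in Hw; destruct Hw.
  - intros c d Hd (_ & _ & Hcd & _) w Hw; auto.
  - intros c c' Hc Hc'.
    destruct (elem_list c) as [l Hl], (elem_list c') as [l' Hl'].
    set (n := pfst c + pfst c'); set (L := l ++ l').
    assert (Hu : forall wv, exists u, I (fst wv) -> I (snd wv) ->
      I u /\ strict_ext (fst wv) u /\ Fo u (snd wv)).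
    { intros [w v]; simpl; destruct (classic (I w /\ I v)) as [[Hw Hv]|N].
      - destruct (H2 w v Hw Hv) as [u Hu]; eauto.
      - exists 0; tauto. }
    destruct (choice _ Hu) as [u Hu'].
    (* The upper bound gathers the empty word, both conditions, all members of [I] below [n], and an
       extension in [I] for each pair; its stage exceeds both given ones. *)
    destruct (condition_ex (S n) (0 :: L ++
       filter (fun v => if decide (I v) then true else false) (seq 0 n) ++
       map u (list_prod L L))) as (z & Hz & Hez).
    assert (HL : forall w, In w L -> I w).
    { intros w Hw; apply in_app_iff in Hw; destruct Hw as [Hw|Hw].
      - now apply Hc, Hl.
      - now apply Hc', Hl'. }
    assert (Hr : forall b, pfst b <= n -> (forall w, elem b w -> In w L) ->
      refines Fo b z).
    { intros b Hb HbL; split; [lia|split; [|split; [|split]]].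
      - apply Hez; now left.
      - intros w Hw; apply Hez; right; apply in_app_iff; auto.
      - intros w v Hw Hv Hf; apply Hez; right; apply in_app_iff; right.
        apply in_app_iff; left; apply filter_In; split; [apply in_seq; lia|].
        destruct (decide (I v)) as [|N]; [reflexivity|].
        destruct N; apply (H1 w v); auto.
      - intros w v Hw Hv; exists (u (w, v)); split; [|apply (Hu' (w, v)); simpl; auto].
        apply Hez; right; apply in_app_iff; right; apply in_app_iff; right.
        apply in_map, in_prod; auto. }
    exists z; split; [|split].
    + intros w Hw; apply Hez in Hw; destruct Hw as [<-|Hw]; [exact H0|].
      rewrite !in_app_iff, filter_In, in_map_iff in Hw.
      destruct Hw as [Hw|[[_ Hw]|([a b] & <- & Hab)]]; [auto| |].
      * destruct (decide (I w)); [assumption|discriminate].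
      * apply in_prod_iff in Hab; apply (Hu' (a, b)); apply HL; tauto.
    + apply Hr; [lia|]; intros w Hw; apply in_app_iff; left; now apply Hl.
    + apply Hr; [lia|]; intros w Hw; apply in_app_iff; right; now apply Hl'.
Qed.

Lemma ideal_conditions Fo J : rounded_ideal (refines Fo) J ->
  exists I, saturated Fo I /\ J = conditions I.
Proof.
  intros ([c0 Hc0] & H2 & H3); set (I := fun w => exists c, J c /\ elem c w).
  assert (Hup : forall c, J c -> exists d, J d /\ refines Fo c d).
  { intros c Hc; destruct (H3 c c Hc Hc) as (d & Hd & H & _); eauto. }
  assert (Hst : forall n, exists c, J c /\ n <= pfst c).
  { induction n as [|n [c [Hc Hn]]]; [exists c0; split; [exact Hc0|lia]|].
    destruct (Hup c Hc) as (d & Hd & [L _]); exists d; split; [exact Hd|lia]. }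
  assert (Hjoin : forall c d, J c -> J d -> exists z, J z /\ pfst c <= pfst z /\
    pfst d <= pfst z /\ (forall w, elem c w \/ elem d w -> elem z w)).
  { intros c d Hc Hd; destruct (H3 c d Hc Hd) as
      (z & Hz & (L & _ & E & _) & (L' & _ & E' & _)).
    exists z; split; [exact Hz|split; [lia|split; [lia|intros w [Hw|Hw]; auto]]]. }
  assert (Hfin : forall n l, (forall w, In w l -> I w) ->
    exists z, J z /\ n <= pfst z /\ forall w, In w l -> elem z w).
  { intros n; induction l as [|w l IH]; intros Hl.
    - destruct (Hst n) as (c & Hc & Hn); exists c; split; [exact Hc|].
      split; [exact Hn|intros w []].
    - destruct IH as (z & Hz & Hn & He); [intros v Hv; apply Hl; now right|].
      destruct (Hl w (or_introl eq_refl)) as (c & Hc & Hw).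
      destruct (Hjoin z c Hz Hc) as (y & Hy & L & _ & E).
      exists y; split; [exact Hy|split; [lia|]]; intros v [<-|Hv]; auto. }
  exists I; split; [split; [|split]|].
  - destruct (Hup c0 Hc0) as (d & Hd & _ & E & _); now exists d.
  - intros w v Hw Hf.
    (* Stage [S v] makes the demand for the forced word [v] active. *)
    destruct (Hfin (S v) (w :: nil)) as (z & Hz & Hn & He); [now intros u [<-|[]]|].
    destruct (Hup z Hz) as (y & Hy & _ & _ & _ & H & _); exists y; split; [exact Hy|].
    apply (H w v); [apply He; now left|lia|exact Hf].
  - intros w v Hw Hv.
    destruct (Hfin 0 (w :: v :: nil)) as (z & Hz & _ & He);
      [now intros u [<-|[<-|[]]]|].
    destruct (Hup z Hz) as (y & Hy & _ & _ & _ & _ & H).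
    destruct (H w v) as (u & Hu & Hext); [apply He; simpl; auto..|].
    exists u; split; [now exists y|exact Hext].
  - apply set_ext; intros c; split; [intros Hc w Hw; now exists c|].
    intros Hc; destruct (elem_list c) as [l Hl].
    destruct (Hfin (pfst c) l) as (z & Hz & Hn & He).
    { intros w Hw; now apply Hc, Hl. }
    assert (E : forall w, elem c w -> elem z w) by (intros w Hw; now apply He, Hl).
    destruct (Hup z Hz) as (y & Hy & L & E0 & Ezy & Hf & Hx).
    (* [y] refines [z], which contains [c] and has a stage no lower, so [y] meets every demand of
       [c]; downward closure puts [c] in [J]. *)
    apply (H2 c y Hy); split; [lia|split; [exact E0|split; [auto|split]]].
    + intros w v Hw Hv; apply Hf; [auto|lia].
    + intros w v Hw Hv; auto.
Qed.

(** A point corresponds to the finite subsets of its set of words. Backwards, an ideal yields the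
    neighbourhood filter of the point, and admissibility turns that into a name. *)
Lemma total_rep_quasi_Polish {X : Type} (d : representation X) :
  effectively_fiber_overt d -> computably_admissible d -> total d ->
  precomputably_quasi_Polish (RepSpace d).
Proof.
  intros Hfo Had Ht.
  destruct (forcing_ex d Hfo) as (Fo & HFd & HF).
  destruct (semi_cyl d Hfo) as (M & HM & HMc).
  set (R := refines Fo).
  assert (Hid : forall x, rounded_ideal R (conditions (fun w => cyl d w x))).
  { intros x; now apply conditions_ideal, cyl_saturated. }
  assert (Hsur : forall J : RI R, exists x : X,
    proj1_sig J = conditions (fun w => cyl d w x)).
  { intros [J HJ]; simpl; destruct (ideal_conditions Fo J HJ) as (I & HI & E).
    destruct (saturated_cyl d Fo I HF Ht HI) as [x Hx].
    exists x; rewrite E; f_equal; now apply set_ext. }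
  destruct (choice _ Hsur) as [g Hg].
  set (f := fun x => exist _ _ (Hid x) : RI R).
  assert (Hgf : forall x, g (f x) = x).
  { intros x; apply (cyl_inj d); [exact Had|]; intros w.
    pose proof (conditions_inj _ _ (Hg (f x))) as E.
    now rewrite (f_equal (fun A => A w) E). }
  assert (Hfg : forall J, f (g J) = J).
  { intros J; apply sig_eq; symmetry; apply Hg. }
  exists R; split; [apply refines_trans|split; [now apply ce_refines|]].
  exists f, g; split; [exact Hgf|split; [exact Hfg|split]].
  - apply computable_map_iff.
    destruct (run_enumeration (fun p c => forall i, i < plen (psnd c) ->
      M p (pnth (psnd c) i))) as [e He]; [solve_semi|].
    exists e; intros p x Hp; destruct (He p) as (q & Hq & Hqn).
    exists q; split; [exact Hq|]; intros c; rewrite <- Hqn; simpl; split.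
    + intros H i Hi; apply (HMc p x _ Hp), H; now exists i.
    + intros H w (i & Hi & <-); now apply (HMc p x _ Hp), H.
  - pose proof (semi_rgt _ semi_verif) as Hv.
    pose proof dec_elem as Hel.
    (* An open set contains the point iff it is verified on some word occurring in a condition of
       the ideal. *)
    destruct (names_open_intro (fun o u _ => exists w,
      (exists c, (exists l, o l = S c) /\ elem c w) /\ verif u w)
      (OpenSets (RepSpace d))) as (F & HFc & Hn).
    { unfold semi2, lft; set (V := fun o w => verif (rgt o) w) in *.
      change (semi (fun o _ => exists w,
        (exists c, (exists l, o (npair 0 l) = S c) /\ elem c w) /\ V o w)).
      clearbody V; solve_semi. }
    destruct (run_comp (fun o i => F o 0 i)) as [e He];
      [unfold cfun in HFc; solve_comp|].
    destruct Had as [Hinj (G & [r Hr] & HG)].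
    apply computable_map_iff; exists (psub r e); intros o J Ho.
    assert (Hx : names (rep (OpenSets (OpenSets (RepSpace d)))) (F o 0)
                   (nbhds (RepSpace d) (g J))).
    { apply Hn; intros u U Hu; unfold in_open at 1; simpl.
      assert (HI : forall w, (exists c, (exists l, o l = S c) /\ elem c w) <->
                             cyl d w (g J)).
      { intros w; setoid_rewrite <- (Ho : forall n, proj1_sig J n <-> _).
        rewrite Hg; split; [intros (c & Hc & Hw); auto|]; intros Hw.
        destruct (condition_ex 0 (w :: nil)) as (c & _ & Hc); exists c.
        split; [|apply Hc; now left]; intros v Hvw; apply Hc in Hvw.
        destruct Hvw as [<-|[]]; exact Hw. }
      setoid_rewrite HI; split.
      - intros (w & (q & Hq & E) & Hw).
        apply (memb_iff _ u U q _ Hu Hq); exists (plen w); now rewrite E.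
      - intros HU; destruct (names_surj d (g J)) as [q Hq].
        apply (memb_iff _ u U q _ Hu Hq) in HU; destruct HU as [k Hk].
        exists (prefix q k); split; [|exact Hk]; exists q.
        now rewrite plen_prefix. }
    destruct (HG _ _ Hx (ex_intro _ _ eq_refl)) as (q & y & Hq & Hy & E).
    apply Hinj in E; subst y; exists q; split; [|exact Hy].
    exact (run_psub _ _ _ _ _ (He o) (Hr _ _ Hq)).
Qed.

(** * Separability and the cycle of implications *)

Lemma isomorphic_trans X Y Z : computably_isomorphic X Y ->
  computably_isomorphic Y Z -> computably_isomorphic X Z.
Proof.
  intros (f & g & H1 & H2 & Hf & Hg) (f' & g' & H1' & H2' & Hf' & Hg').
  exists (fun x => f' (f x)), (fun z => g (g' z)).
  split; [intros x; now rewrite H1'|split; [intros z; now rewrite H2|]].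
  split; eapply computable_map_comp; eassumption.
Qed.

(** By totality each padded word [pnth i] names a point, and every cylinder contains one of these
    sequences, so the points are dense. *)
Lemma total_rep_separable (X : repspace) (d : representation X) :
  admits X d -> total d -> effectively_separable X.
Proof.
  intros [_ Hfrom] Ht.
  destruct (choice (fun i x => names d (pnth i) x)) as [a Ha]; [intros i; apply Ht|].
  exists a; split.
  - refine (computable_map_comp natspace (RepSpace d) X a (fun x => x) _ Hfrom).
    apply computable_map_iff.
    destruct (run_comp (fun o i => pnth (o 0) i)) as [e He]; [solve_comp|].
    exists e; intros p n Hp; exists (pnth (p 0)); split; [apply He|].
    simpl in Hp; rewrite Hp; apply Ha.
  - intros U HU [x Hx]; apply (computable_map_open _ _ _ _ Hfrom) in HU.
    destruct (cyl_open d U x HU Hx) as (w & _ & Hw).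
    exists w; apply Hw; exists (pnth w); split; [apply Ha|apply prefix_pnth].
Qed.

Theorem theorem14 (X : repspace) (HX : inhabited X) :
  let S1 := precomputably_quasi_Polish X /\ effectively_separable X in
  let S2 := precomputably_quasi_Polish X /\ computably_overt X in
  let S3 := exists d : representation X,
      admits X d /\ effectively_fiber_overt d /\ computably_admissible d /\
      total d in
  let S4 := exists R : nat -> nat -> Prop,
      transitive nat R /\ ce_rel R /\ computably_isomorphic X (RI R) /\
      ce (extendable R) in
  (S1 <-> S2) /\ (S2 <-> S3) /\ (S3 <-> S4).
Proof.
  intros S1 S2 S3 S4.
  (* The implications form the cycle [S1], [S2], [S4], [S3], [S1]. *)
  assert (H12 : S1 -> S2).
  { intros [Hq Hs]; split; [exact Hq|now apply separable_overt]. }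
  assert (H24 : S2 -> S4).
  { intros [(R & HR & HRce & Hi) Ho]; exists R.
    repeat split; auto; now apply (overt_extendable X). }
  assert (H43 : S4 -> S3).
  { intros (R & HR & HRce & Hi & HE); now apply (extendable_total_rep X R). }
  assert (H31 : S3 -> S1).
  { intros (d & Ha & Hf & Hc & Ht); split; [|now apply (total_rep_separable X d)].
    destruct (total_rep_quasi_Polish d Hf Hc Ht) as (R & HR & HRce & Hi).
    exists R; split; [exact HR|split; [exact HRce|]].
    apply (isomorphic_trans X (RepSpace d)); [|exact Hi].
    destruct Ha; exists (fun x => x), (fun x => x); auto. }
  tauto.
Qed.
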